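(* Let $\eta>0$. Assume that $i\mathbb{R}\subset\rho(\mathcal{A})$, that $i\mathbb{R}\subset\rho(\mathcal{A}_0)$, and that $$\limsup_{\omega\in\mathbb{R},\,|\omega|\to+\infty}\big\|M(|\omega|)^{-1}(i\omega I-\mathcal{A}_0)^{-1}\big\|_{\mathcal{L}(\mathcal{H}_0)}<+\infty,$$ where $M$ is a nondecreasing function on $\mathbb{R}_+$ with $M>0$ on $(0,+\infty)$. Then there exists a constant $C>0$ such that $$\|(i\omega I-\mathcal{A})^{-1}\|_{\mathcal{L}(\mathcal{H})}\le C|\omega|^{1-\alpha}M(|\omega|),\qquad\forall\,\omega\ge1.$$
   Context: Let $H$ be a complex Hilbert space and $A:\mathcal{D}(A)\subset H\to H$ a self-adjoint and strictly positive operator. For $\beta\ge0$, $H_\beta=\mathcal{D}(A^\beta)$ with norm $\|z\|_\beta=\|A^\beta z\|_H$, and $H_{-\beta}=H_\beta^*$ is the dual with respect to the pivot space $H$; $A$ extends (or restricts) to a bounded operator $H_\beta\to H_{\beta-1}$ for every $\beta\in\mathbb{R}$. Let $U$ be a Hilbert space identified with its dual, $B:U\to H_{-\frac12}$ a bounded linear operator, and $B^*:H_{\frac12}\to U$ its adjoint. Let $0<\alpha<1$, $\gamma=\frac{2\sin(\alpha\pi)\Gamma(\frac12+1)}{\pi^{\frac12+1}}$, $p(\xi)=|\xi|^{\frac{2\alpha-1}{2}}$ ($\xi\in\mathbb{R}$). Let $V=L^2(\mathbb{R};U)$ and $\mathcal{H}=H_{\frac12}\times H\times V$ with inner product $$\langle(u_1,v_1,\varphi_1),(u_2,v_2,\varphi_2)\rangle_{\mathcal{H}}=\langle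 A^{\frac12}u_1,A^{\frac12}u_2\rangle_H+\langle v_1,v_2\rangle_H+\gamma\int_{\mathbb{R}}\langle\varphi_1(\xi),\varphi_2(\xi)\rangle_U\,\mathrm{d}\xi.$$ The operator $\mathcal{A}:\mathcal{D}(\mathcal{A})\subset\mathcal{H}\to\mathcal{H}$ is $$\mathcal{A}(u,v,\varphi)=\Big(v,\ -Au-\gamma B\int_{\mathbb{R}}p(\xi)\varphi(\xi)\,\mathrm{d}\xi,\ -(|\xi|^2+\eta)\varphi+p(\xi)B^*v\Big),$$ with domain $$\mathcal{D}(\mathcal{A})=\Big\{(u,v,\varphi)\in\mathcal{H}:\ v\in H_{\frac12},\ Au+\gamma B\int_{\mathbb{R}}p(\xi)\varphi(\xi)\,\mathrm{d}\xi\in H,\ |\xi|\varphi\in L^2(\mathbb{R};U),\ -(|\xi|^2+\eta)\varphi+p(\xi)B^*v\in L^2(\mathbb{R};U)\Big\}.$$ Let $\mathcal{H}_0=H_{\frac12}\times H$ and $\mathcal{A}_0:\mathcal{D}(\mathcal{A}_0)\subset\mathcal{H}_0\to\mathcal{H}_0$, $\mathcal{A}_0(w,v)=(v,-Aw-BB^*v)$, with domain $\mathcal{D}(\mathcal{A}_0)=\{(w,v)\in\mathcal{H}_0:\ v\in H_{\frac12},\ Aw+BB^*v\in H\}$. $\rho(\cdot)$ denotes the resolvent set. *)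

(* Defs.v *)
From HB Require Import structures.
From mathcomp Require Import all_boot all_order all_algebra.
From mathcomp Require Import sesquilinear ring_quotient generic_quotient.
From mathcomp Require Import complex ring lra.
From mathcomp Require Import all_classical all_reals all_analysis.
From mathcomp Require Import measurable_realfun.
Set Implicit Arguments.
Unset Strict Implicit.
Unset Printing Implicit Defensive.
Import Order.TTheory GRing.Theory Num.Theory.
Import numFieldNormedType.Exports.
Local Open Scope classical_set_scope.
Local Open Scope ring_scope.
Local Open Scope quotient_scope.

(** * Hilbert spaces *)

(* In MathComp, a [dot] form is linear in its first argument and conjugate
   linear in the second one. *)
Record hilbertSpace (R : realType) := HilbertSpace {
  hilbert_sort :> completeNormedModType R[i] ;
  dotp : {dot hilbert_sort for (Num.conj : R[i] -> R[i])} ;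
  dotp_norm : forall x, `|x| ^+ 2 = dotp x x
}.

(* The norm of a normed module over [R[i]] is valued in [R[i]]; this is the same
   norm, valued in [R]. *)
Definition rnorm (R : realType) (E : normedModType R[i]) (x : E) : R :=
  complex.Re `|x|.
Arguments rnorm {R E} x.

Section Rnorm.
Context {R : realType} {E : normedModType R[i]}.

Lemma rnormE (x : E) : `|x| = (rnorm x)%:C%C.
Proof.
have /= := normr_ge0 x; rewrite /rnorm lecE.
case: `|x| => a b /= /andP[/eqP -> _].
by [].
Qed.

Lemma rnorm_ge0 (x : E) : 0 <= rnorm x.
Proof.
by rewrite -lecR -rnormE normr_ge0.
Qed.

Lemma rnorm_leD (x y : E) : rnorm (x + y) <= rnorm x + rnorm y.
Proof.
by have := ler_normD x y; rewrite !rnormE -rmorphD lecR.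
Qed.

Lemma rnormZ (a : R[i]) (x : E) : rnorm (a *: x) = complex.Re `|a| * rnorm x.
Proof.
by rewrite /rnorm normrZ rnormE normc_def /= mulr0 subr0.
Qed.

Lemma cvg_rnorm (T : Type) (F : set_system T) (FF : Filter F) (f : T -> E)
  (x : E) : f @ F --> x -> rnorm (f t) @[t --> F] --> rnorm x.
Proof.
move=> /cvgrPdist_lt fx; apply/cvgrPdist_lt => e e0.
have /fx : 0 < e%:C%C by rewrite ltcR.
apply: filterS => t; rewrite -ltcR; apply: le_lt_trans.
suff -> : (`|rnorm x - rnorm (f t)|%:C)%C = `| `|x| - `|f t| |.
  exact: ler_dist_dist.
by rewrite !rnormE -rmorphB normc_def /= expr0n /= addr0 sqrtr_sqr.
Qed.

End Rnorm.

(** * Unbounded operators, resolvents *)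

(* The values of [app] outside of [dom] are irrelevant. *)
Record operator (E : Type) := Operator { dom : set E ; app :> E -> E }.

Section Resolvent.
Context {R : realType} {E : lmodType R[i]}.
Variables (N : E -> R) (T : operator E).

Definition opnorm (f : E -> E) : \bar R :=
  ereal_sup [set (N (f x))%:E | x in [set x | N x <= 1]].

(* [(lambda I - T)^-1] *)
Definition resolvent (lambda : R[i]) (y : E) : E :=
  xget 0 [set x | dom T x /\ lambda *: x - T x = y].

Definition resolvent_set : set R[i] :=
  [set lambda | set_bij (dom T) setT (fun x => lambda *: x - T x)
    /\ (opnorm (resolvent lambda) < +oo)%E].

End Resolvent.

Section HilbertOperators.
Context {R : realType} (H : hilbertSpace R).

Record linearOperator := LinearOperator {
  linop :> operator H ;
  linop_dom : GRing.submod_closed (mem (dom linop)) ;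
  linop_lin : forall (a : R[i]) (x y : H), dom linop x -> dom linop y ->
    linop (a *: x + y) = a *: linop x + linop y
}.

Implicit Types T S A : linearOperator.

(* [T] is densely defined and its graph is the graph of its adjoint. *)
Definition selfadjoint T :=
  dense (dom T) /\
  forall x y : H, (dom T x /\ T x = y) <->
    (forall z, dom T z -> dotp H (T z) x = dotp H z y).

Definition nonneg_operator T :=
  forall x : H, dom T x -> 0 <= dotp H (T x) x.

Definition strictly_positive T :=
  exists2 m : R, 0 < m &
    forall x : H, dom T x -> (m%:C)%C * dotp H x x <= dotp H (T x) x.

(* [S = A^(1/2)]: the nonnegative self-adjoint operator such that [S S = A],
   domains included. *)
Definition is_sqrt S A :=
  [/\ selfadjoint S, nonneg_operator S,
      forall x : H, dom A x <-> dom S x /\ dom S (S x) &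
      forall x : H, dom A x -> A x = S (S x)].

End HilbertOperators.

(** * The scale [H_(1/2)], [H], [H_(-1/2)], for [S = A^(1/2)] *)

Section HalfScale.
Context {R : realType} {H : hilbertSpace R} (S : linearOperator H).

Definition half_pred : {pred H} := mem (dom S).

Lemma half_pred_closed : GRing.submod_closed half_pred.
Proof. exact: linop_dom. Qed.

HB.instance Definition _ :=
  GRing.isSubmodClosed.Build R[i] H half_pred half_pred_closed.

Record halfSpace := HalfSpace {
  half_val : H ;
  half_valP : half_val \in half_pred
}.

HB.instance Definition _ := [isSub for half_val].
HB.instance Definition _ := [Choice of halfSpace by <:].
HB.instance Definition _ := [SubChoice_isSubLmodule of halfSpace by <:].

End HalfScale.

(** * Strong measurability, Bochner integral, [L^2(R; U)] *)

Section Bochner.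
Context {R : realType} (U : hilbertSpace R).
Local Notation mu := (@lebesgue_measure R).
Implicit Types (f g : R -> U) (s : R -> U).

(* Finitely many values, each on a Borel set. *)
Definition simple_function s :=
  finite_set (range s) /\ forall y : U, measurable (s @^-1` [set y]).

(* The limit holds everywhere: every almost everywhere limit of simple functions
   is almost everywhere equal to such a function, so this choice does not change
   [L^2(R; U)] below, and it makes the norm of [f] Borel measurable. *)
Definition strongly_measurable f :=
  exists2 s : nat -> R -> U, forall n, simple_function (s n) &
    forall x, s ^~ x @ \oo --> f x.

Definition integrable_simple s :=
  simple_function s /\
  forall y : U, y != 0 -> (mu (s @^-1` [set y]) < +oo)%E.

(* If [0] is a value of [s], its term vanishes, even when [mu] is infinite. *)
Definition simple_integral s : U :=
  \sum_(y \in range s) (fine (mu (s @^-1` [set y])))%:C%C *: y.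

Definition is_bochner_integral f (I : U) :=
  strongly_measurable f /\
  exists s : nat -> R -> U,
    [/\ forall n, integrable_simple (s n),
        (fun n => \int[mu]_x (rnorm (f x - s n x))%:E)%E @ \oo --> 0%E &
        simple_integral (s n) @[n --> \oo] --> I].

Definition bochner_integral f : U := xget 0 [set I | is_bochner_integral f I].

(* [f] is a representative of an element of [L^2(R; U)]. *)
Definition L2_function f :=
  strongly_measurable f /\ (\int[mu]_x ((rnorm (f x)) ^+ 2)%:E < +oo)%E.

Definition L2_pred : {pred (R -> U)} := mem [set f | L2_function f].

Lemma simple_function_lin (a : R[i]) s1 s2 : simple_function s1 ->
  simple_function s2 -> simple_function (a *: s1 + s2).
Proof.
move=> [f1 m1] [f2 m2]; split.
  apply: (@sub_finite_set _ _ [set a *: x + y | x in range s1 & y in range s2]).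
    by move=> _ [t _ <-]; exists (s1 t); [exists t|exists (s2 t); [exists t|]].
  exact: finite_image2.
move=> y.
have -> : (a *: s1 + s2) @^-1` [set y] =
    \bigcup_(x in range s1) (s1 @^-1` [set x] `&` s2 @^-1` [set y - a *: x]).
  have ev t : (a *: s1 + s2) t = a *: s1 t + s2 t by [].
  apply/seteqP; split => t /=; rewrite ev.
    move=> <-; exists (s1 t); first by exists t.
    by split => //=; rewrite addrC addKr.
  by move=> [x _ [/= -> ->]]; rewrite addrC subrK.
apply: fin_bigcup_measurable => // x _; exact: measurableI.
Qed.

Lemma strongly_measurable_lin (a : R[i]) f g : strongly_measurable f ->
  strongly_measurable g -> strongly_measurable (a *: f + g).
Proof.
move=> [s hs sf] [t ht tg]; exists (fun n => a *: s n + t n).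
  by move=> n; apply: simple_function_lin.
move=> x; apply: cvgD; last exact: tg.
by apply: cvgZr; apply: sf.
Qed.

Lemma measurable_rnorm f : strongly_measurable f ->
  measurable_fun setT (rnorm \o f).
Proof.
move=> [s hs sf].
apply: (@measurable_realfun.measurable_fun_cvg _ _ _ _ (fun n => rnorm \o s n)).
  move=> n _ Y mY; rewrite setTI.
  have [fs ms] := hs n.
  have -> : (rnorm \o s n) @^-1` Y =
      \bigcup_(y in range (s n) `&` [set y | Y (rnorm y)]) (s n @^-1` [set y]).
    apply/seteqP; split => t /=.
      by move=> Yt; exists (s n t) => //; split => //; exists t.
    by move=> [y [_ Yy] /= ->].
  by apply: fin_bigcup_measurable => //; apply: finite_setIl.
by move=> x _; apply: cvg_rnorm; apply: sf.
Qed.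

Lemma L2_pred_closed : GRing.submod_closed L2_pred.
Proof.
split.
  rewrite inE /=; split.
    exists (fun=> 0) => [n|x]; last exact: cvg_cst.
    split; last first.
      by move=> y; rewrite preimage_cst; case: ifP => _.
    by apply: (@sub_finite_set _ _ [set 0]) => // _ [t _ <-].
  under eq_integral do rewrite /rnorm normr0 /= expr0n.
  by rewrite integral0.
move=> a f g; rewrite !inE /= => -[mf If] [mg Ig].
have mh := strongly_measurable_lin a mf mg; split=> //.
have msq h : strongly_measurable h ->
    measurable_fun setT (fun x => (rnorm (h x) ^+ 2)%:E).
  move=> /measurable_rnorm mh'; apply/measurable_EFinP.
  exact: (measurable_funX 2 mh').
pose k := 2 * complex.Re `|a| ^+ 2 : R.
have k0 : 0 <= k by rewrite mulr_ge0// sqr_ge0.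
have le : (\int[mu]_x ((rnorm ((a *: f + g) x)) ^+ 2)%:E <=
   \int[mu]_x (k%:E * (rnorm (f x) ^+ 2)%:E + 2%:E * (rnorm (g x) ^+ 2)%:E))%E.
  apply: ge0_le_integral => //.
  - by move=> x _; rewrite lee_fin sqr_ge0.
  - exact: msq.
  - by apply: emeasurable_funD; apply: emeasurable_funM => //; exact: msq.
  - move=> x _; rewrite -!EFinM -EFinD lee_fin.
    have := rnorm_leD (a *: f x) (g x); rewrite rnormZ.
    set u := _ * _; set v := rnorm (g x) => h.
    apply: (@le_trans _ _ ((u + v) ^+ 2)).
      by rewrite lerXn2r// nnegrE ?rnorm_ge0// (le_trans (rnorm_ge0 _) h).
    have : 0 <= (u - v) ^+ 2 by exact: sqr_ge0.
    rewrite /k /u; nra.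
apply: (le_lt_trans le).
rewrite ge0_integralD //.
- rewrite !ge0_integralZl_EFin //; try exact: msq.
  + by apply: lte_add_pinfty; apply: lte_mul_pinfty => //; rewrite lee_fin.
  + by move=> x _; rewrite lee_fin sqr_ge0.
  + by move=> x _; rewrite lee_fin sqr_ge0.
- by move=> x _; rewrite -EFinM lee_fin mulr_ge0// sqr_ge0.
- by apply: emeasurable_funM => //; exact: msq.
- by move=> x _; rewrite -EFinM lee_fin mulr_ge0// sqr_ge0.
- by apply: emeasurable_funM => //; exact: msq.
Qed.

HB.instance Definition _ :=
  GRing.isSubmodClosed.Build R[i] (R -> U) L2_pred L2_pred_closed.

Record L2fun := L2Fun { L2_val :> R -> U ; L2_valP : L2_val \in L2_pred }.

HB.instance Definition _ := [isSub for L2_val].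
HB.instance Definition _ := [Choice of L2fun by <:].
HB.instance Definition _ := [SubChoice_isSubLmodule of L2fun by <:].

Definition ae_zero : {pred L2fun} :=
  mem [set f : L2fun | {ae mu, forall x, f x = 0}].

Local Instance ae_lebesgue_filter : Filter (nbhs (almost_everywhere mu)).
Proof. exact: (@ae_filter_ringOfSetsType _ _ _ mu). Qed.

Lemma ae_zero_closed : zmod_closed ae_zero.
Proof.
split; rewrite ?inE /=; first exact: aeW.
move=> f g; rewrite !inE /= => hf hg.
apply: filterS2 hf hg => x /= fx gx.
by change (L2_val f x - L2_val g x = 0); rewrite fx gx subrr.
Qed.

HB.instance Definition _ :=
  GRing.isZmodClosed.Build L2fun ae_zero ae_zero_closed.

Definition L2space : Type := Quotient.quot ae_zero.

HB.instance Definition _ := Choice.on L2space.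
HB.instance Definition _ := GRing.Zmodule.on L2space.

Definition L2_pi (f : L2fun) : L2space := \pi f.

Lemma L2_piP (f g : L2fun) :
  L2_pi f = L2_pi g <-> {ae mu, forall x, f x = g x}.
Proof.
split.
  move=> /eqP; rewrite -Quotient.idealrBE inE /=.
  by apply: filterS => x /= /eqP; rewrite subr_eq0 => /eqP.
move=> h; apply/eqP; rewrite -Quotient.idealrBE inE /=.
apply: filterS h => x /= fg.
by change (L2_val f x - L2_val g x = 0); rewrite fg subrr.
Qed.

Lemma L2_piD : {morph L2_pi : f g / f + g}.
Proof. exact: Quotient.pi_add. Qed.

Lemma L2_reprK (x : L2space) : L2_pi (repr x) = x.
Proof. exact: reprK. Qed.

Definition L2_scale (a : R[i]) (x : L2space) : L2space := L2_pi (a *: repr x).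

Lemma L2_scale_pi a (f : L2fun) : L2_scale a (L2_pi f) = L2_pi (a *: f).
Proof.
have /L2_piP h : L2_pi (repr (L2_pi f)) = L2_pi f by rewrite /L2_pi reprK.
apply/L2_piP; apply: filterS h => x /= hx.
by change (a *: L2_val (repr (L2_pi f)) x = a *: L2_val f x); rewrite hx.
Qed.

Lemma L2_scaleA a b x : L2_scale a (L2_scale b x) = L2_scale (a * b) x.
Proof.
by rewrite -[x]L2_reprK !L2_scale_pi scalerA.
Qed.

Lemma L2_scale1 : left_id 1 L2_scale.
Proof.
by move=> x; rewrite -[x]L2_reprK L2_scale_pi scale1r.
Qed.

Lemma L2_scaleDr : right_distributive L2_scale +%R.
Proof.
move=> a x y; rewrite -[x]L2_reprK -[y]L2_reprK -L2_piD.
by rewrite !L2_scale_pi scalerDr L2_piD.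
Qed.

Lemma L2_scaleDl x : {morph L2_scale^~ x : a b / a + b}.
Proof.
by move=> a b; rewrite -[x]L2_reprK !L2_scale_pi scalerDl L2_piD.
Qed.

HB.instance Definition _ := GRing.Zmodule_isLmodule.Build R[i] L2space
  L2_scaleA L2_scale1 L2_scaleDr L2_scaleDl.

(* The class of [f], for [L2_function f]; [0] otherwise. *)
Definition L2_class (f : R -> U) : L2space := L2_pi (insubd 0 f).

Definition L2_repr (x : L2space) : R -> U := repr x : L2fun.

Definition L2_dotp (x y : L2space) : R[i] :=
  let h t := dotp U (L2_repr x t) (L2_repr y t) in
  ((\int[mu]_t complex.Re (h t)) +i* (\int[mu]_t complex.Im (h t)))%C.

End Bochner.

Section HalfScaleNorms.
Context {R : realType} {H : hilbertSpace R} (S : linearOperator H).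
Local Notation H12 := (halfSpace S).
Implicit Types (u v w : H12) (l : H12 -> R[i]).

Definition half_dotp u v : R[i] := dotp H (S (half_val u)) (S (half_val v)).

Definition half_norm u : R := rnorm (S (half_val u)).

Definition dual_norm l : \bar R :=
  ereal_sup [set (complex.Re `|l w|)%:E | w in [set w | half_norm w <= 1]].

(* [H_(-1/2)]: the bounded conjugate linear functionals on [H_(1/2)]. With this
   convention the embedding of [H] by the inner product is complex linear. *)
Definition dual_half : set (H12 -> R[i]) :=
  [set l | (forall (a : R[i]) v w, l (a *: v + w) = Num.conj a * l v + l w)
    /\ (dual_norm l < +oo)%E].

Definition pivot (h : H) : H12 -> R[i] := fun w => dotp H h (half_val w).

(* [l : H_(-1/2)] as an element of [H], for [l] in the range of [pivot]. *)
Definition of_pivot (l : H12 -> R[i]) : H := xget 0 [set h | pivot h = l].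

(* [A : H_(1/2) -> H_(-1/2)], for [S = A^(1/2)]: the bounded extension of the
   operator [A] of domain [D(A)], which is dense in [H_(1/2)]; see [ext_opE]. *)
Definition ext_op u : H12 -> R[i] :=
  fun w => dotp H (S (half_val u)) (S (half_val w)).

Lemma ext_opE (A : linearOperator H) : is_sqrt S A ->
  forall u, dom A (half_val u) -> ext_op u = pivot (A (half_val u)).
Proof.
move=> [[_ sS] _ dA AE] u du; apply/funext => w; rewrite /ext_op /pivot AE//.
have [dSu dSSu] := (dA _).1 du.
have dw : dom S (half_val w) by have := half_valP w; rewrite inE.
by have /sS/(_ _ dSSu) /esym := conj dw (erefl (S (half_val w))).
Qed.

(* [h : H] as an element of [H_(1/2)], for [h] in [D(A^(1/2))]. *)
Definition to_half (h : H) : H12 := insubd 0 h.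

End HalfScaleNorms.

Section Damping.
Context {R : realType} {H U : hilbertSpace R} (S : linearOperator H).
Local Notation H12 := (halfSpace S).
Local Notation V := (L2space U).

Record boundedToDual := BoundedToDual {
  bdual :> U -> H12 -> R[i] ;
  bdual_range : forall y, dual_half (bdual y) ;
  bdual_lin : forall (a : R[i]) (y z : U) w,
    bdual (a *: y + z) w = a * bdual y w + bdual z w ;
  bdual_bounded : exists K : R, forall y,
    (dual_norm (bdual y) <= (K * rnorm y)%:E)%E
}.

Definition is_adjoint (B : boundedToDual) (Bs : H12 -> U) :=
  forall y w, B y w = dotp U y (Bs w).

Variables (B : boundedToDual) (Bs : H12 -> U) (alpha eta : R).

Definition Gamma_fun (s : R) : R :=
  \int[@lebesgue_measure R]_(t in `]0, +oo[) (t `^ (s - 1) * expR (- t)).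

Definition damping_const : R :=
  2 * sin (alpha * pi) * Gamma_fun (2^-1 + 1) / (pi `^ (2^-1 + 1)).

(* The value at [xi = 0] is irrelevant. *)
Definition weight (xi : R) : R := `|xi| `^ ((2 * alpha - 1) / 2).

Definition calH : lmodType R[i] := (H12 * H * V)%type.

Definition calH_dotp (x y : calH) : R[i] :=
  half_dotp x.1.1 y.1.1 + dotp H x.1.2 y.1.2
  + damping_const%:C%C * L2_dotp x.2 y.2.

Definition calH_norm (x : calH) : R := Num.sqrt (complex.Re (calH_dotp x x)).

(* [A u + gamma B (int p phi)], in [H_(-1/2)] *)
Definition stress (u : H12) (phi : R -> U) : H12 -> R[i] := fun w =>
  ext_op u w
  + damping_const%:C%C
    * B (bochner_integral (fun xi => (weight xi)%:C%C *: phi xi)) w.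

(* [- (xi^2 + eta) phi + p B^* v] *)
Definition diffusion (v : H) (phi : R -> U) : R -> U := fun xi =>
  - ((`|xi| ^+ 2 + eta)%:C%C *: phi xi) + (weight xi)%:C%C *: Bs (to_half S v).

Definition calA : operator calH := Operator
  [set x | let: (u, v, phi) := x in
     [/\ dom S v,
         exists h, pivot h = stress u (L2_repr phi),
         L2_function (fun xi => `|xi|%:C%C *: L2_repr phi xi) &
         L2_function (diffusion v (L2_repr phi))]]
  (fun x => let: (u, v, phi) := x in
     (to_half S v, - of_pivot (stress u (L2_repr phi)),
      L2_class (diffusion v (L2_repr phi)))).

Definition calH0 : lmodType R[i] := (H12 * H)%type.

Definition calH0_dotp (x y : calH0) : R[i] :=
  half_dotp x.1 y.1 + dotp H x.2 y.2.

Definition calH0_norm (x : calH0) : R :=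
  Num.sqrt (complex.Re (calH0_dotp x x)).

(* [A w + B B^* v], in [H_(-1/2)] *)
Definition stress0 (w : H12) (v : H) : H12 -> R[i] := fun z =>
  ext_op w z + B (Bs (to_half S v)) z.

Definition calA0 : operator calH0 := Operator
  [set x | let: (w, v) := x in
     dom S v /\ exists h, pivot h = stress0 w v]
  (fun x => let: (w, v) := x in (to_half S v, - of_pivot (stress0 w v))).

End Damping.

Arguments boundedToDual {R H} U S.
Arguments calH_norm {R H} U S alpha x.
Arguments calH0_norm {R H} S x.

(* The filter of the sets containing all [omega] with [|omega|] large. *)
Definition abs_infty (R : realType) : set_system R :=
  filter_from setT (fun a : R => [set omega : R | a < `|omega|]).
Arguments abs_infty R : clear implicits.

(* Main.v *)
Require Import Defs.
From mathcomp Require Import all_boot all_order all_algebra.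
From mathcomp Require Import sesquilinear complex finmap ring lra.
From mathcomp Require Import all_classical all_reals all_analysis.
From mathcomp Require Import measurable_realfun.
Import Order.TTheory GRing.Theory Num.Theory.
Import numFieldNormedType.Exports.
Import HBSimple HBNNSimple.
Local Open Scope classical_set_scope.
Local Open Scope ring_scope.
Set Implicit Arguments.
Unset Strict Implicit.
Unset Printing Implicit Defensive.

(** Why the estimate holds. Let [x = (u, v, phi)] solve
    [i omega x - calA x = y] with [y = (f, g, chi)] and [omega >= 1]; write
    [z] for the trace [B^* v], [I] for the integral of [p phi], [D] for the
    integral of [(xi^2 + eta) |phi|^2], [gamma] for the damping constant, [P]
    for [omega^(1 - alpha)] and [m] for a constant multiple of [M omega] that
    bounds the resolvent of [calA0] and is at least 1.

    The quantity [gamma D] is the energy dissipated by [calA]: it is the real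
    part of the scalar product of [x] and [y], hence at most
    [t |x|^2 + |y|^2 / t] for every [t > 0] ([energy_identity]). It controls
    the whole diffusive part of the system. First, [eta |phi|^2 <= D] after
    integration. Next, [|I|^2 <= C D] by the Cauchy-Schwarz inequality, because
    [p^2 / (xi^2 + eta)] is integrable ([integrable_weight_density],
    [bochner_wphi_bound]). Finally, the diffusion equation says that [p z] is
    [(i omega + xi^2 + eta) phi - chi]; on the frequencies
    [sqrt omega <= xi <= 2 sqrt omega] the symbol has size [omega], while the
    integral of [p^2] there has size [omega^alpha], and so
    [|z|^2 <= C P (D + |chi|^2)] ([trace_bound]). This is where the exponent
    [1 - alpha] comes from.

    The pair [(u, v)] solves the resolvent equation of [calA0] with the data
    [(f, g)] and the additional source [B k], where [k = z - gamma I]. This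
    source lies in the dual space only, so the bound on the resolvent of
    [calA0] does not apply to it directly. The adjoint of [calA0] is conjugate
    to [calA0] by [(w, v) |-> (- w, v)], so one may test against the solution
    [(p, q)] of the problem for [calA0] at the frequency [- omega] with data
    [(- u, v)]. The source then only meets [B^* q], whose square is bounded by
    the dissipation of [calA0], that is by [2 m |(u, v)|^2]: one factor [m]
    instead of two. This gives
    [|(u, v)|^2 <= 8 m^2 |(f, g)|^2 + 16 m |k|^2] ([dual_estimate]).

    Together, [|x|^2 <= C (m P)^2 |y|^2 + C m P D], and the choice of [t] of
    size [1 / (m P)] absorbs the last term ([absorb_energy]). The hypothesis on
    the upper limit provides [m] for large frequencies; for the others, the
    resolvent is locally bounded and an interval is compact
    ([resolvent0_uniform_bound]).

    Only real parts of scalar products are used ([rdot]); multiplication by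
    [i omega] is skew for them, and inequalities between squared norms with a
    free parameter ([rdot_young]) replace the Cauchy-Schwarz inequality of the
    product spaces. *)

(** * The real part of the scalar product *)

Definition rdot (R : realType) (H : hilbertSpace R) (x y : H) : R :=
  complex.Re (dotp H x y).

Section RealDot.
Context {R : realType} {H : hilbertSpace R}.
Implicit Types (x y z : H) (a w : R).

Lemma complex_Re_add (c d : R[i]) :
  complex.Re (c + d) = complex.Re c + complex.Re d.
Proof. by case: c d => [? ?] [? ?]. Qed.

Lemma rdotC x y : rdot x y = rdot y x.
Proof. 
rewrite /rdot hermC /= expr0 mul1r.
by case: (dotp H y x).
Qed.

Lemma rdotDl x y z : rdot (x + y) z = rdot x z + rdot y z.
Proof. by rewrite /rdot linearDl /= complex_Re_add. Qed.

Lemma rdotDr x y z : rdot x (y + z) = rdot x y + rdot x z.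
Proof. by rewrite rdotC rdotDl ![rdot _ x]rdotC. Qed.

Lemma rdotZl a x y : rdot (a%:C%C *: x) y = a * rdot x y.
Proof.
rewrite /rdot linearZl_LR /=; case: (dotp H x y) => b c /=.
by rewrite mul0r subr0.
Qed.

Lemma rdotZr a x y : rdot x (a%:C%C *: y) = a * rdot x y.
Proof. by rewrite rdotC rdotZl rdotC. Qed.

Lemma rdotNl x y : rdot (- x) y = - rdot x y.
Proof. by rewrite /rdot linearNl /=; case: (dotp H x y). Qed.

Lemma rdotNr x y : rdot x (- y) = - rdot x y.
Proof. by rewrite rdotC rdotNl rdotC. Qed.

Lemma rdotBl x y z : rdot (x - y) z = rdot x z - rdot y z.
Proof. by rewrite rdotDl rdotNl. Qed.

Lemma rdotBr x y z : rdot x (y - z) = rdot x y - rdot x z.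
Proof. by rewrite rdotDr rdotNr. Qed.

Lemma rdot0l x : rdot 0 x = 0.
Proof. by rewrite /rdot linear0l. Qed.

(** The resolvent parameters lie on the imaginary axis, so this is what makes
    the oscillating terms cancel in all energy identities below. *)
Lemma rdot_skew w x y :
  rdot ((0 +i* w)%C *: x) y = - rdot x ((0 +i* w)%C *: y).
Proof.
rewrite [in RHS]rdotC /rdot !linearZl_LR /= [dotp H y x]hermC /= expr0 mul1r.
by case: (dotp H x y) => b c /=; rewrite !mul0r !sub0r mulrN opprK.
Qed.

Lemma rdot_skew0 w x : rdot ((0 +i* w)%C *: x) x = 0.
Proof. by have := rdot_skew w x x; rewrite [rdot x _]rdotC; lra. Qed.

Lemma rdotxx x : rdot x x = rnorm x ^+ 2.
Proof.
by rewrite /rdot -dotp_norm rnormE -rmorphXn.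
Qed.

Lemma rnorm_eq0 x : rnorm x = 0 -> x = 0.
Proof. by move=> h; apply: normr0_eq0; rewrite rnormE h. Qed.

Lemma rnormN x : rnorm (- x) = rnorm x.
Proof. by rewrite /rnorm normrN. Qed.

Lemma sqr_rnormD x y :
  rnorm (x + y) ^+ 2 = rnorm x ^+ 2 + 2 * rdot x y + rnorm y ^+ 2.
Proof. by rewrite -!rdotxx !rdotDl !rdotDr (rdotC y x); ring. Qed.

Lemma sqr_rnormZ (c : R[i]) x :
  rnorm (c *: x) ^+ 2 = (complex.Re c ^+ 2 + complex.Im c ^+ 2) * rnorm x ^+ 2.
Proof.
rewrite rnormZ exprMn; congr (_ * _).
by case: c => a b; rewrite normc_def /= sqr_sqrtr // addr_ge0 // sqr_ge0.
Qed.

Lemma rnormZr a x : rnorm (a%:C%C *: x) = `|a| * rnorm x.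
Proof. by rewrite rnormZ normc_def /= expr0n addr0 sqrtr_sqr. Qed.

Lemma rdot_polar x y :
  rdot x y = 4^-1 * (rnorm (x + y) ^+ 2 - rnorm (x - y) ^+ 2).
Proof. by rewrite !sqr_rnormD rnormN rdotNr; field. Qed.

(** Used in place of the triangle inequality, since all estimates are between
    squared norms. *)
Lemma sqr_rnormD_le x y :
  rnorm (x + y) ^+ 2 <= 2 * rnorm x ^+ 2 + 2 * rnorm y ^+ 2.
Proof.
have := sqr_ge0 (rnorm (x - y)); rewrite !sqr_rnormD rnormN rdotNr; lra.
Qed.

(** The parameter is chosen, at each use, so that one of the two terms can be
    absorbed. *)
Lemma rdot_young t x y : 0 < t ->
  rdot x y <= t * rnorm x ^+ 2 + t^-1 * rnorm y ^+ 2.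
Proof.
move=> t0; have := sqr_ge0 (rnorm (t%:C%C *: x - y)).
rewrite sqr_rnormD rnormN rdotNr rdotZl rnormZr exprMn real_normK ?num_real//
  => h.
rewrite -(ler_pM2l t0) mulrDr mulVKf ?gt_eqF//.
have := sqr_ge0 (t * rnorm x); have := sqr_ge0 (rnorm y); rewrite exprMn; nra.
Qed.

Lemma normr_rdot_young t x y : 0 < t ->
  `|rdot x y| <= t * rnorm x ^+ 2 + t^-1 * rnorm y ^+ 2.
Proof.
move=> t0; rewrite ler_norml rdot_young// andbT lerNl -rdotNl.
by rewrite -(rnormN x) rdot_young.
Qed.

(** The vector [y] minus its projection on [x] has a nonnegative squared norm.
    *)
Lemma normr_rdot x y : `|rdot x y| <= rnorm x * rnorm y.
Proof.
have [-> | x0] := eqVneq x 0.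
  by rewrite rdot0l normr0 mulr_ge0 ?rnorm_ge0.
have xp : 0 < rnorm x.
  by rewrite lt_def rnorm_ge0 andbT; apply: contraNN x0 => /eqP/rnorm_eq0 ->.
have := sqr_ge0 (rnorm (((rdot x y) / rnorm x ^+ 2)%:C%C *: x - y)).
rewrite sqr_rnormD rnormN rdotNr rdotZl rnormZr exprMn real_normK ?num_real//
  => h.
rewrite -ler_sqr ?nnegrE ?mulr_ge0 ?rnorm_ge0// real_normK ?num_real// exprMn.
set d := rdot x y in h *; set a := rnorm x in h xp *; set b := rnorm y in h *.
have e : (d / a ^+ 2) ^+ 2 * a ^+ 2 + 2 * - (d / a ^+ 2 * d) + b ^+ 2 = 
  (a ^+ 2 * b ^+ 2 - d ^+ 2) / a ^+ 2 by field; rewrite gt_eqF.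
by move: h; rewrite e pmulr_lge0 ?invr_gt0 ?exprn_gt0// subr_ge0.
Qed.

End RealDot.

(** * Strongly measurable functions *)

Section StrongMeasurability.
Context {R : realType} {U : hilbertSpace R}.
Local Notation mu := (@lebesgue_measure R).
Implicit Types (f g : R -> U) (s : R -> U).

(** The values of the two arguments split the line into finitely many Borel
    sets, on which the result is constant. *)
Lemma simple_function2 (T1 T2 : Type) (s1 : R -> T1) (s2 : R -> T2)
    (F : T1 -> T2 -> U) :
  finite_set (range s1) -> (forall y, measurable (s1 @^-1` [set y])) ->
  finite_set (range s2) -> (forall y, measurable (s2 @^-1` [set y])) ->
  simple_function (fun t => F (s1 t) (s2 t)).
Proof.
move=> f1 m1 f2 m2; split.
  apply: (@sub_finite_set _ _ [set F x y | x in range s1 & y in range s2]).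
    by move=> _ [t _ <-]; exists (s1 t); [exists t|exists (s2 t); [exists t|]].
  exact: finite_image2.
move=> z.
have -> : (fun t => F (s1 t) (s2 t)) @^-1` [set z] =
    \bigcup_(x in range s1) \bigcup_(y in range s2 `&` [set y | F x y = z])
      (s1 @^-1` [set x] `&` s2 @^-1` [set y]).
  apply/seteqP; split => t /=.
    move=> e; exists (s1 t); first by exists t.
    by exists (s2 t) => //; split => //; exists t.
  by move=> [x _ [y [_ /= e] /= [-> ->]]].
apply: fin_bigcup_measurable => // x _.
apply: fin_bigcup_measurable; first exact: finite_setIl.
by move=> y _; exact: measurableI.
Qed.

Lemma strongly_measurable_cst (z : U) : strongly_measurable (fun=> z : U).
Proof.
exists (fun=> fun=> z) => [n|x]; last exact: cvg_cst.
split; last by move=> y; rewrite preimage_cst; case: ifP.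
by apply: (@sub_finite_set _ _ [set z]) => // _ [t _ <-].
Qed.

Lemma cvg_real_complex (T : Type) (F : set_system T) (FF : Filter F)
  (p : T -> R) (l : R) : p @ F --> l ->
  ((p t)%:C%C : R[i]^o) @[t --> F] --> (l%:C%C : R[i]^o).
Proof.
move=> /cvgrPdist_lt pl; apply/cvgrPdist_lt => e e0.
have e1 : e = (complex.Re e)%:C%C.
  by move: e0; case: e => a b; rewrite ltcE /= => /andP[/eqP -> _].
rewrite e1 ltcR in e0; apply: filterS (pl _ e0) => t.
by rewrite -rmorphB normc_def /= expr0n addr0 sqrtr_sqr e1 ltcR.
Qed.

(** The nonnegative factor is itself a pointwise limit of simple functions. *)
Lemma strongly_measurable_scale (p : R -> R) f :
  measurable_fun setT p -> (forall x, 0 <= p x) ->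
  strongly_measurable f -> strongly_measurable (fun t => (p t)%:C%C *: f t).
Proof.
move=> mp p0 [s hs sf].
have mp' : measurable_fun setT (EFin \o p) by apply/measurable_EFinP.
pose q n := nnsfun_approx measurableT mp' n.
exists (fun n t => (q n t)%:C%C *: s n t) => [n|x].
  have [fs ms] := hs n.
  apply: (simple_function2 (s1 := q n) (s2 := s n) (fun a z => a%:C%C *: z))
    => //.
apply: cvgZ; last exact: sf.
apply: cvg_real_complex.
by have /fine_cvgP[_] := @cvg_nnsfun_approx _ _ _ _ measurableT _ mp'
  (fun x _ => p0 x) x I.
Qed.

Lemma strongly_measurableD f g : strongly_measurable f ->
  strongly_measurable g -> strongly_measurable (fun t => f t + g t).
Proof.
move=> mf mg; have := strongly_measurable_lin 1 mf mg.
by congr strongly_measurable; apply/funext => t; rewrite fctE /= scale1r.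
Qed.

Lemma strongly_measurableB f g : strongly_measurable f ->
  strongly_measurable g -> strongly_measurable (fun t => f t - g t).
Proof.
move=> mf mg; have := strongly_measurable_lin (-1) mg mf.
by congr strongly_measurable; apply/funext => t; rewrite fctE /= scaleN1r addrC.
Qed.

(** By polarization, only the measurability of norms is needed. *)
Lemma measurable_rdot f g : strongly_measurable f -> strongly_measurable g ->
  measurable_fun setT (fun t => rdot (f t) (g t)).
Proof.
move=> mf mg.
under eq_fun do rewrite rdot_polar.
apply: measurable_funM => //; apply: measurable_funB.
  by apply: measurable_funX; exact: (measurable_rnorm (strongly_measurableD mf
    mg)).
by apply: measurable_funX; exact: (measurable_rnorm (strongly_measurableB mf
  mg)).
Qed.

End StrongMeasurability.

(** * The Bochner integral *)

Section BochnerIntegral.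
Context {R : realType} {U : hilbertSpace R}.
Local Notation mu := (@lebesgue_measure R).
Implicit Types (f g : R -> U) (s : R -> U).

Lemma simple_strongly_measurable s : simple_function s -> strongly_measurable s.
Proof. by move=> hs; exists (fun=> s) => // x; exact: cvg_cst. Qed.

Lemma rdot_sum (T : Type) (r : seq T) (F : T -> U) z :
  rdot (\sum_(i <- r) F i) z = \sum_(i <- r) rdot (F i) z.
Proof.
apply: (big_morph (fun x => rdot x z)) => [x y|]; first exact: rdotDl.
exact: rdot0l.
Qed.

Lemma integral_indicT (A : set R) : measurable A ->
  (\int[mu]_t (\1_A t)%:E = mu A)%E.
Proof. by move=> mA; rewrite integral_indic// setIT. Qed.

Lemma integrable_indic_lty (A : set R) : measurable A -> (mu A < +oo)%E ->
  mu.-integrable setT (fun t => (\1_A t)%:E).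
Proof.
move=> mA muA; apply/integrableP; split; first exact/measurable_EFinP.
under eq_integral do rewrite gee0_abs//.
by rewrite integral_indicT.
Qed.

(** Scalar products with the integral of a simple function determine
    everything that is needed about it: linearity and the triangle inequality
    for the integral will be read off on these scalar products. *)
Lemma simple_integralE s z : integrable_simple s ->
  mu.-integrable setT (fun t => (rdot (s t) z)%:E) /\
  (\int[mu]_t (rdot (s t) z)%:E = (rdot (simple_integral s) z)%:E)%E.
Proof.
move=> [[fs ms] sfin].
pose r : seq U := enum_fset (fset_set (range s)).
pose F y t : \bar R := ((rdot y z)%:E * (\1_(s @^-1` [set y]) t)%:E)%E.
have sE t : ((rdot (s t) z)%:E = \sum_(y <- r) F y t)%E.
  have st : s t \in fset_set (range s) by rewrite in_fset_set// inE; exists t.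
  rewrite (bigD1_seq (s t)) ?fset_uniq//= big1 ?adde0.
    by rewrite /F indicE mem_set//= mule1.
  move=> y /eqP yn; rewrite /F indicE memNset ?mule0// => /= e; apply: yn.
  by rewrite -e.
have iF y : mu.-integrable setT (F y).
  (* The fibre of 0 may have infinite measure, but its term vanishes. *)
  rewrite /F; have [->|y0] := eqVneq y 0.
    by rewrite rdot0l; under eq_fun do rewrite mul0e; exact: integrable0.
  apply: integrableZl => //; apply: integrable_indic_lty => //; exact: sfin.
split.
  under eq_fun do rewrite sE.
  by apply: integrable_sum => // y _ _; exact: iF.
under eq_integral do rewrite sE.
rewrite (integral_sum _ iF)//.
rewrite /simple_integral fsbig_finite//= -/r rdot_sum.
rewrite -sumEFin; apply: eq_bigr => y _.
rewrite rdotZl /F; have [->|y0] := eqVneq y 0.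
  rewrite rdot0l mulr0.
  by under eq_integral do rewrite mul0e; rewrite integral0.
rewrite integralZl//; last by apply: integrable_indic_lty => //; exact: sfin.
rewrite integral_indicT// EFinM muleC fineK//.
by rewrite ge0_fin_numE//; exact: sfin.
Qed.

Lemma integrable_rdot_cst f z : strongly_measurable f ->
  mu.-integrable setT (fun t => (rnorm (f t))%:E) ->
  mu.-integrable setT (fun t => (rdot (f t) z)%:E).
Proof.
move=> mf i.
apply: (le_integrable _ _ _ (integrableZl measurableT (rnorm z) i)) => //.
  by apply/measurable_EFinP; apply: measurable_rdot => //;
    exact: strongly_measurable_cst.
move=> t _; rewrite -EFinM !abse_EFin lee_fin.
by rewrite [leRHS]ger0_norm ?mulr_ge0 ?rnorm_ge0// mulrC normr_rdot.
Qed.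

Lemma measurable_rnormB f s : strongly_measurable f -> simple_function s ->
  measurable_fun setT (fun t => rnorm (f t - s t)).
Proof.
move=> mf hs; apply: (measurable_rnorm (f := fun t => f t - s t)).
by apply: strongly_measurableB => //; exact: simple_strongly_measurable.
Qed.

(** The linear form [z |-> \int rdot (f t) z] is the only candidate for the
    scalar product with the integral of [f]; simple approximations of [f]
    approach it uniformly for [z] in the unit ball. *)
Lemma simple_integral_dist f s z : strongly_measurable f ->
  mu.-integrable setT (fun t => (rnorm (f t))%:E) -> integrable_simple s ->
  (`|rdot (simple_integral s) z - \int[mu]_t rdot (f t) z|%:E <=
   (rnorm z)%:E * \int[mu]_t (rnorm (f t - s t))%:E)%E.
Proof.
move=> mf iF hs; have [is_ es] := simple_integralE z hs.
have i := integrable_rdot_cst z mf iF.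
rewrite -ge0_integralZl_EFin ?rnorm_ge0//; last first.
- by apply/measurable_EFinP; apply: measurable_rnormB => //; case: hs.
- by move=> t _; rewrite lee_fin rnorm_ge0.
rewrite distrC -abse_EFin EFinB -es /Rintegral fineK; last first.
  exact: integrable_fin_num.
rewrite -(integralB measurableT i is_).
apply: (le_trans (le_abse_integral _ _ _)) => //.
  exact: (measurable_int _ (integrableB _ i is_)).
apply: ge0_le_integral => //.
- by apply: measurableT_comp => //;
    exact: (measurable_int _ (integrableB _ i is_)).
- apply/measurable_EFinP; apply: measurable_funM => //.
  by apply: measurable_rnormB => //; case: hs.
- move=> t _; rewrite -EFinB -EFinM abse_EFin lee_fin -rdotBl mulrC.
  exact: normr_rdot.
Qed.

End BochnerIntegral.

Section BochnerExistence.
Context {R : realType} {U : hilbertSpace R}.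
Local Notation mu := (@lebesgue_measure R).
Implicit Types (f g : R -> U) (s : R -> U).

(** Truncating at [2 |f|] makes the approximations dominated by an integrable
    function, and changes them only finitely often at a point where [f] is
    nonzero. *)
Definition truncate f s t : U :=
  if rnorm (s t) <= 2 * rnorm (f t) then s t else 0.

(** A nonzero value is taken only where [2 |f|] is at least its norm, which is
    a set of finite measure by the Markov inequality. *)
Lemma truncate_integrable f s : strongly_measurable f ->
  mu.-integrable setT (fun t => (rnorm (f t))%:E) -> simple_function s ->
  integrable_simple (truncate f s).
Proof.
move=> mf iF hs; have [fs ms] := hs.
have mb : measurable_fun setT (fun t => rnorm (s t) <= 2 * rnorm (f t)).
  apply: measurable_fun_ler.
    exact: (measurable_rnorm (simple_strongly_measurable hs)).
  by apply: measurable_funM => //; exact: (measurable_rnorm mf).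
have ht : simple_function (truncate f s).
  apply: (simple_function2 (s1 := fun t => rnorm (s t) <= 2 * rnorm (f t))
    (s2 := s) (fun (b : bool) y => if b then y else 0)) => //.
  by move=> b; rewrite -[X in measurable X]setTI; exact: mb.
split => // y y0; have [_ mt] := ht.
have mi : measurable_fun setT
    (fun t => (\1_(truncate f s @^-1` [set y]) t)%:E : \bar R).
  by apply/measurable_EFinP; apply: measurable_indic; exact: mt.
have ny : 0 < rnorm y.
  by rewrite lt_def rnorm_ge0 andbT; apply: contraNN y0 => /eqP/rnorm_eq0 ->.
have iF2 := integrableZl measurableT 2 iF.
have : ((rnorm y)%:E * mu (truncate f s @^-1` [set y]) < +oo)%E.
  rewrite -(integral_indicT (mt y)) -ge0_integralZl_EFin ?rnorm_ge0//.
  apply: le_lt_trans (integrable_lty measurableT iF2).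
  apply: ge0_le_integral => //.
  - by move=> t _; rewrite -EFinM lee_fin mulr_ge0// rnorm_ge0.
  - apply: emeasurable_funM => //; exact: mi.
  - exact: (measurable_int _ iF2).
  - move=> t _; rewrite -!EFinM lee_fin indicE.
    have [|_] := boolP (t \in _); last by rewrite mulr0 mulr_ge0// rnorm_ge0.
    rewrite inE /= /truncate mulr1; case: ifP => [h <- //|_ y0'].
    by rewrite -y0' eqxx in y0.
by rewrite -lte_pdivlMl// mulry gtr0_sg ?mul1e// invr_gt0.
Qed.

Lemma truncate_le f s t : rnorm (f t - truncate f s t) <= 3 * rnorm (f t).
Proof.
have := rnorm_ge0 (f t); rewrite /truncate; case: ifP => h h0.
  by have := rnorm_leD (f t) (- s t); rewrite rnormN; lra.
by rewrite subr0; lra.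
Qed.

Lemma cvg_truncate f (s : nat -> R -> U) t : s ^~ t @ \oo --> f t ->
  (fun n => rnorm (f t - truncate f (s n) t)) @ \oo --> 0.
Proof.
move=> sf.
have c : (fun n => rnorm (f t - s n t)) @ \oo --> 0.
  have -> : 0 = rnorm (f t - f t) by rewrite subrr /rnorm normr0.
  by apply: cvg_rnorm; apply: cvgB => //; exact: cvg_cst.
(* Where [f] vanishes, all truncated values do. *)
have [f0|f0] := eqVneq (rnorm (f t)) 0.
  apply: cvg_near_cst; apply: nearW => n.
  have e := rnorm_ge0 (f t - truncate f (s n) t).
  by have := truncate_le f (s n) t; rewrite f0; lra.
have fp : 0 < rnorm (f t) by rewrite lt_def f0 rnorm_ge0.
have cs : (fun n => rnorm (s n t)) @ \oo --> rnorm (f t) by exact: cvg_rnorm.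
apply: cvg_trans c; apply: near_eq_cvg.
have : rnorm (f t) < 2 * rnorm (f t) by lra.
move=> /(cvgr_lt _ cs); apply: filterS => n h.
by rewrite /truncate ltW.
Qed.

(** Truncated approximations converge to [f] in the mean by dominated
    convergence, and then their integrals form a Cauchy sequence. *)
Lemma bochner_integral_ex f : strongly_measurable f ->
  mu.-integrable setT (fun t => (rnorm (f t))%:E) ->
  exists I, is_bochner_integral f I.
Proof.
move=> mf iF; have [s hs sf] := mf.
pose t n := truncate f (s n).
have ht n : integrable_simple (t n) by exact: truncate_integrable.
pose e n := (\int[mu]_x (rnorm (f x - t n x))%:E)%E.
have me n : measurable_fun setT (fun x => (rnorm (f x - t n x))%:E).
  by apply/measurable_EFinP; apply: measurable_rnormB => //; case: (ht n).
have e0 : e @ \oo --> 0%E.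
  have iF3 := integrableZl measurableT 3 iF.
  have := @dominated_cvg _ _ _ mu setT measurableT
    (fun n x => (rnorm (f x - t n x))%:E) (cst 0)%E (fun x => 3%:E * (rnorm (f
      x))%:E)%E.
  rewrite integral0; apply => //.
  - move=> x _; apply: cvg_EFin; first exact: nearW.
    exact: cvg_truncate.
  - move=> n x _; rewrite -EFinM abse_EFin lee_fin ger0_norm ?rnorm_ge0//.
    exact: truncate_le.
have ep n : (0 <= e n)%E by apply: integral_ge0 => x _;
  rewrite lee_fin rnorm_ge0.
have cau : cauchy (simple_integral (t n) @[n --> \oo]).
  apply: cauchy_exP => eps eps0.
  have epsE : eps = (complex.Re eps)%:C%C.
    by move: eps0; case: eps => a b; rewrite ltcE /= => /andP[/eqP -> _].
  rewrite epsE ltcR in eps0; set d := complex.Re eps in epsE eps0.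
  have d2 : 0 < d / 2 by rewrite divr_gt0.
  have /fine_cvgP[finE /cvgrPdist_lt/(_ _ d2) small] := e0.
  (* Cauchy criterion: all integrals of large index are close to the one of
     index [N]. *)
  have [N _ hN0] : \forall n \near \oo,
      `|0 - fine (e n)| < d / 2 /\ e n \is a fin_num.
    by apply: filterS2 small finE.
  have [sN fN] := hN0 N (leqnn N).
  exists (simple_integral (t N)); exists N => // n /= /hN0[sn fn].
  rewrite -ball_normE /= epsE rnormE ltcR.
  set D := simple_integral (t N) - _.
  have h m (z : U) : e m \is a fin_num ->
    `|rdot (simple_integral (t m)) z - \int[mu]_x rdot (f x) z| <=
    rnorm z * fine (e m).
    move=> fm; rewrite -lee_fin EFinM fineK//.
    exact: simple_integral_dist.
  have hN := h N D fN; have hn := h n D fn.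
  have : rdot D D <= rnorm D * (fine (e N) + fine (e n)).
    (* The norm of the difference [D] is found by testing with [D] itself. *)
    rewrite {1}/D rdotBl; move: hN hn;
      rewrite !ler_norml => /andP[_ a] /andP[b _].
    by lra.
  rewrite rdotxx expr2; have [->//|D0] := eqVneq (rnorm D) 0.
  rewrite ler_pM2l; last by rewrite lt_def D0 rnorm_ge0.
  move: sN sn; rewrite !sub0r !normrN !ger0_norm ?fine_ge0//.
  by lra.
exists (lim (simple_integral (t n) @[n --> \oo])); split => //.
exists t; split => //; exact: cauchy_cvg.
Qed.

(** The integral in the definition of [stress] takes a default value when it
    does not exist, so the energy identity depends on this lemma and its
    hypotheses. *)
Lemma bochner_rdot f z : strongly_measurable f ->
  mu.-integrable setT (fun t => (rnorm (f t))%:E) ->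
  rdot (bochner_integral f) z = \int[mu]_t rdot (f t) z.
Proof.
move=> mf iF.
have [I hI] := bochner_integral_ex mf iF.
have /= := xgetPex 0 (ex_intro _ _ hI); rewrite -/(bochner_integral f).
set J := bochner_integral f => -[_ [s [hs e0 sJ]]].
have c1 : (fun n => rdot (simple_integral (s n)) z) @ \oo --> rdot J z.
  under eq_fun do rewrite rdot_polar; rewrite rdot_polar.
  apply: cvgM; first exact: cvg_cst.
  apply: cvgB; rewrite expr2; under eq_fun do rewrite expr2;
    apply: cvgM; apply: cvg_rnorm.
  - by apply: cvgD => //; exact: cvg_cst.
  - by apply: cvgD => //; exact: cvg_cst.
  - by apply: cvgB => //; exact: cvg_cst.
  - by apply: cvgB => //; exact: cvg_cst.
suff c2 : (fun n => rdot (simple_integral (s n)) z) @ \oo -->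
    \int[mu]_t rdot (f t) z by exact: (cvg_unique _ c1 c2).
have /fine_cvgP[finE /cvgrPdist_lt small] := e0.
apply/cvgrPdist_lt => d d0.
have d1 : 0 < d / (rnorm z + 1).
  by rewrite divr_gt0// ltr_wpDl// rnorm_ge0.
apply: filterS2 finE (small _ d1) => n /= fn.
rewrite sub0r normrN ger0_norm; last first.
  by rewrite fine_ge0// integral_ge0// => x _; rewrite lee_fin rnorm_ge0.
have := simple_integral_dist z mf iF (hs n).
rewrite -[X in ((rnorm z)%:E * X)%E]fineK// -EFinM lee_fin distrC.
have z1 : 0 < rnorm z + 1 by rewrite ltr_wpDl// rnorm_ge0.
rewrite ltr_pdivlMr// => h1 h2; apply: le_lt_trans h1 _.
apply: le_lt_trans h2; rewrite mulrC ler_wpM2l//; last by rewrite lerDl.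
by rewrite fine_ge0// integral_ge0// => x _; rewrite lee_fin rnorm_ge0.
Qed.

End BochnerExistence.

(** * The weight p *)

Section Weight.
Context {R : realType}.
Local Notation mu := (@lebesgue_measure R).

Lemma integral_powR_itv (a b r : R) : 0 < a -> a < b -> r != 0 ->
  (\int[mu]_(x in `[a, b]) (x `^ (r - 1))%:E = ((b `^ r - a `^ r) / r)%:E)%E.
Proof.
move=> a0 ab r0; pose F x := r^-1 * x `^ r.
have dF (x : R) : 0 < x -> is_derive x 1 F (x `^ (r - 1)).
  move=> x0; have := is_derive1_powR r x0 => h.
  rewrite /F; apply: is_derive_eq.
  by rewrite /GRing.scale /= mulKf.
have cF (x : R) : 0 < x -> {for x, continuous F}.
  move=> x0; apply: differentiable_continuous; apply/derivable1_diffP.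
  by have := dF x x0 => ?; exact: ex_derive.
rewrite (@continuous_FTC2 _ _ F)//.
- by rewrite -EFinB /F -mulrBr mulrC.
- apply: derivable_within_continuous => x; rewrite in_itv /= => /andP[ax _].
  have x0 := lt_le_trans a0 ax.
  by have := is_derive1_powR (r - 1) x0 => ?; exact: ex_derive.
- split.
  + move=> x; rewrite in_itv /= => /andP[ax _].
    by have := dF x (lt_trans a0 ax) => ?; exact: ex_derive.
  + by apply: cvg_at_right_filter; exact: cF.
  + by apply: cvg_at_left_filter; apply: cF; exact: lt_trans ab.
- move=> x; rewrite in_itv /= => /andP[ax _].
  have := dF x (lt_trans a0 ax) => ?; rewrite derive1E; exact: derive_val.
Qed.

(** The bound keeps only one end of the interval, which is why it survives
    when the other end tends to 0 (for [r > 0]) or to infinity (for [r < 0]).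
    *)
Lemma integral_powR_itv_le (a b r : R) : 0 < a -> a < b -> r != 0 ->
  (\int[mu]_(x in `[a, b]) (x `^ (r - 1))%:E <=
    ((if 0 < r then b `^ r else a `^ r) / `|r|)%:E)%E.
Proof.
move=> a0 ab r0; rewrite integral_powR_itv// lee_fin.
have [rp|rn] := ltP 0 r.
  rewrite gtr0_norm// ler_pM2r ?invr_gt0// lerBlDr lerDl; exact: powR_ge0.
have rn' : r < 0 by rewrite lt_neqAle r0.
rewrite ltr0_norm// invrN mulrN -mulNr ler_nM2r ?invr_lt0//.
rewrite lerNl opprB lerBlDr lerDl; exact: powR_ge0.
Qed.

Variables (alpha eta : R).
Hypotheses (halpha : 0 < alpha < 1) (heta : 0 < eta).

Lemma measurable_weight : measurable_fun setT (weight alpha).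
Proof.
exact: (measurableT_comp (measurable_powR _) (@normr_measurable R setT)).
Qed.

Lemma weight_ge0 x : 0 <= weight alpha x.
Proof. exact: powR_ge0. Qed.

Lemma weightN x : weight alpha (- x) = weight alpha x.
Proof. by rewrite /weight normrN. Qed.

Lemma sqr_weight x : weight alpha x ^+ 2 = `|x| `^ (2 * alpha - 1).
Proof.
rewrite /weight -powR_mulrn ?powR_ge0// -powRrM; congr (_ `^ _).
by field.
Qed.

(** Its integral is the squared norm of [p] in the norm dual to the one of the
    dissipated energy [D]. *)
Definition weight_density (x : R) := weight alpha x ^+ 2 / (`|x| ^+ 2 + eta).

Lemma weight_density_ge0 x : 0 <= weight_density x.
Proof. by rewrite divr_ge0 ?sqr_ge0// addr_ge0 ?sqr_ge0// ltW. Qed.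

Lemma measurable_weight_density : measurable_fun setT weight_density.
Proof.
apply: measurable_funM; first exact: (measurable_funX 2 measurable_weight).
under eq_fun => x do rewrite -powR_inv1 ?addr_ge0 ?sqr_ge0 ?(ltW heta)//.
apply: (measurableT_comp (measurable_powR (-1))) => //.
apply: measurable_funD => //; apply: (measurable_funX 2);
  exact: normr_measurable.
Qed.

(** The density behaves like [x^(2 alpha - 1)] at 0 and like [x^(2 alpha - 3)]
    at infinity; both are integrable because [0 < alpha < 1]. *)
Lemma integral_weight_density_itv (a b : R) : 0 < a -> a < 1 -> 1 < b ->
  (\int[mu]_(x in `[a, b]) (weight_density x)%:E <=
   (eta^-1 / (2 * alpha) + (2 - 2 * alpha)^-1)%:E)%E.
Proof.
move=> a0 a1 b1; have /andP[al0 al1] := halpha.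
have mg D : measurable_fun D (fun x => (weight_density x)%:E).
  by apply/measurable_EFinP; apply: measurable_funTS;
    exact: measurable_weight_density.
have mp r D : measurable_fun D (fun x : R => (x `^ r)%:E).
  by apply/measurable_EFinP; apply: measurable_funTS; exact: measurable_powR.
have -> : `[a, b]%classic = `[a, 1] `|` `]1, b].
  rewrite -itv_bndbnd_setU// bnd_simp; exact: ltW.
rewrite ge0_integral_setU//; last 3 first.
- exact: mg.
- by move=> x _; rewrite lee_fin weight_density_ge0.
- apply/disj_setPS => x [] /=; rewrite !in_itv /= => /andP[_ x1] /andP[x1' _].
  by move: x1'; rewrite ltNge x1.
rewrite EFinD; apply: leeD.
- apply: (@le_trans _ _ (\int[mu]_(x in `[a, 1%R]) (eta^-1%:E * (x `^ (2 *
    alpha - 1)%R)%:E))%E).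
    apply: ge0_le_integral => //.
    + by move=> x _; rewrite lee_fin weight_density_ge0.
    + exact: mg.
    + by apply: emeasurable_funM => //; exact: mp.
    + move=> x; rewrite /= in_itv /= => /andP[ax _].
      have x0 := lt_le_trans a0 ax.
      rewrite -EFinM lee_fin /weight_density sqr_weight (gtr0_norm x0) mulrC.
      by rewrite ler_wpM2r ?powR_ge0// lef_pV2 ?posrE ?lerDr ?sqr_ge0//
        ltr_wpDl ?sqr_ge0.
  rewrite ge0_integralZl_EFin ?invr_ge0 ?(ltW heta)//; last 2 first.
  - by move=> x _; rewrite lee_fin powR_ge0.
  - exact: mp.
  rewrite EFinM; apply: lee_wpmul2l; first by rewrite lee_fin invr_ge0 ltW.
  have al2 : 0 < 2 * alpha by rewrite mulr_gt0.
  have := @integral_powR_itv_le a 1 (2 * alpha) a0 a1 (lt0r_neq0 al2).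
  by rewrite al2 powR1 gtr0_norm// mul1r.
- have al3 : 2 * alpha - 2 < 0 by lra.
  apply: (@le_trans _ _ (\int[mu]_(x in `[1%R, b]) (x `^ (2 * alpha - 2 -
    1)%R)%:E)%E).
    apply: (@le_trans _ _ (\int[mu]_(x in `[1%R, b]) (weight_density x)%:E)%E).
      apply: ge0_subset_integral => //.
      + exact: mg.
      + by move=> x _; rewrite lee_fin weight_density_ge0.
      + exact: subset_itv_oc_cc.
    apply: ge0_le_integral => //.
    + by move=> x _; rewrite lee_fin weight_density_ge0.
    + exact: mg.
    + exact: mp.
    + move=> x; rewrite /= in_itv /= => /andP[ax _].
      have x0 : 0 < x by exact: lt_le_trans ax.
      rewrite lee_fin /weight_density sqr_weight (gtr0_norm x0).
      have -> : 2 * alpha - 2 - 1 = 2 * alpha - 1 - 2%:R by ring.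
      rewrite [leRHS]powRB; last by rewrite (gt_eqF x0) implybT.
      rewrite powR_mulrn ?(ltW x0)// ler_wpM2l ?powR_ge0//.
      by rewrite lef_pV2 ?posrE ?exprn_gt0 ?lerDl ?(ltW heta)// ltr_wpDl
        ?sqr_ge0.
  have := @integral_powR_itv_le 1 b (2 * alpha - 2) ltr01 b1 (ltr0_neq0 al3).
  rewrite ltNge (ltW al3) /= powR1 ltr0_norm// mul1r.
  by rewrite opprB.
Qed.

(** Exhaust the positive half-line by the intervals [[1/(n+2), n+2]], and
    reflect. *)
Lemma integrable_weight_density :
  mu.-integrable setT (fun x => (weight_density x)%:E).
Proof.
have mg D : measurable_fun D (fun x => (weight_density x)%:E).
  by apply/measurable_EFinP; apply: measurable_funTS;
    exact: measurable_weight_density.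
have g0 x : (0 <= (weight_density x)%:E)%E by rewrite lee_fin
  weight_density_ge0.
apply/integrableP; split; first exact: mg.
under eq_integral do rewrite gee0_abs//.
pose K := (eta^-1 / (2 * alpha) + (2 - 2 * alpha)^-1)%:E.
pose F n : set R := `[(n.+2%:R)^-1, n.+2%:R]%classic.
have FE : \bigcup_n F n = `]0, +oo[%classic.
  apply/seteqP; split => x.
    move=> [n _]; rewrite /F /= !in_itv /= andbT => /andP[h _].
    by apply: lt_le_trans h; rewrite invr_gt0.
  rewrite /= in_itv /= andbT => x0.
  (* Both [x] and its inverse have to be below [n + 2]. *)
  pose y := x + x^-1.
  have [n xn] : exists n : nat, y <= n.+2%:R.
    exists (Num.truncn y); apply: (@le_trans _ _ (Num.truncn y).+1%:R).
      by apply: ltW; exact: Num.Theory.truncnS_gt.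
    by rewrite ler_nat.
  exists n => //; rewrite /F /= in_itv /=; apply/andP; split.
    rewrite -(invrK x) lef_pV2 ?posrE ?invr_gt0//; apply: le_trans xn.
    by rewrite /y lerDr ltW.
  by apply: le_trans xn; rewrite /y lerDl invr_ge0 ltW.
have lepos : (\int[mu]_(x in `[0%R, +oo[) (weight_density x)%:E <= K)%E.
  rewrite -integral_itv_obnd_cbnd// -FE.
  have nF : nondecreasing_seq F.
    apply/nondecreasing_seqP => n; rewrite subsetEset /F.
    apply: subset_itv; rewrite bnd_simp ?ler_nat//.
    by rewrite lef_pV2 ?posrE ?ltr0n// ler_nat.
  have cF : (\int[mu]_(x in F n) (weight_density x)%:E @[n --> \oo] -->
      \int[mu]_(x in \bigcup_n F n) (weight_density x)%:E)%E.
    apply: ge0_nondecreasing_set_cvg_integral => // n; last exact: mg.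
    exact: measurable_itv.
  apply: (cvge_to_le cF).
  apply: nearW => n; apply: integral_weight_density_itv.
  - by rewrite invr_gt0.
  - by rewrite invf_lt1// ltr1n.
  - by rewrite ltr1n.
have leneg : (\int[mu]_(x in `]-oo, 0%R]) (weight_density x)%:E <= K)%E.
  apply: le_trans lepos.
  rewrite ge0_integration_by_substitution0//.
  under eq_integral => x _ do rewrite -[weight_density _]/(weight alpha x ^+ 2
    / (`|x| ^+ 2 + eta)).
  under [leRHS]eq_integral => x _ do
     rewrite -[weight_density _]/(weight alpha (- x) ^+ 2 / (`|- x| ^+ 2 +
       eta)) weightN normrN.
  by [].
have -> : [set: R] = `]-oo, 0%R] `|` `]0%R, +oo[.
  apply/seteqP; split => // x _ /=; rewrite !in_itv /= andbT.
  by case: (leP x 0) => [|]; [left|right].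
rewrite ge0_integral_setU//; last 2 first.
- exact: mg.
- apply/disj_setPS => x [] /=; rewrite !in_itv /= andbT => x1.
  by rewrite ltNge x1.
rewrite integral_itv_obnd_cbnd; last exact: mg.
by apply: (le_lt_trans (leeD leneg lepos)); rewrite -EFinD ltry.
Qed.

End Weight.

(** * Positivity of the damping constant *)

Section DampingConst.
Context {R : realType}.
Local Notation mu := (@lebesgue_measure R).

(** The real-valued integral would be 0 if it diverged, so convergence has to
    be proved as well: the integrand is at most [exp (- t / 2)], and on [[1,
    2]] it is at least [exp (- 2)]. *)
Lemma Gamma_fun_3half_gt0 : 0 < Gamma_fun (2^-1 + 1 : R).
Proof.
rewrite /Gamma_fun addrK.
pose g (t : R) := t `^ (2^-1) * expR (- t).
have g0 t : 0 <= g t by rewrite mulr_ge0 ?powR_ge0 ?expR_ge0.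
have mg D : measurable_fun D (fun t => (g t)%:E).
  apply/measurable_EFinP; apply: measurable_funTS; apply: measurable_funM.
    exact: measurable_powR.
  by apply: measurableT_comp => //; exact: measurable_oppr.
have fin : (\int[mu]_(t in `]0%R, +oo[) (g t)%:E < +oo)%E.
  apply: (@le_lt_trans _ _ (\int[mu]_t (2%:E * (exponential_pdf (2^-1)
    t)%:E))%E).
    rewrite integral_mkcond; apply: ge0_le_integral => //.
    - by move=> t _; apply: erestrict_ge0 => x _; rewrite lee_fin.
    - apply/(measurable_restrictT _ _).1 => //; exact: mg.
    - apply: emeasurable_funM => //; apply/measurable_EFinP.
      exact: measurable_exponential_pdf.
    - move=> t _; rewrite patchE; case: ifPn; last first.
        by move=> _; rewrite -EFinM lee_fin mulr_ge0// exponential_pdf_ge0.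
      rewrite inE /= in_itv /= andbT => t0.
      rewrite -EFinM lee_fin exponential_pdfE ?(ltW t0)// mulrA divff// mul1r.
      rewrite /g powR12_sqrt ?(ltW t0)// mulNr.
      (* Half of the exponential absorbs the square root: [sqrt t <= 1 + t / 2
         <= exp (t / 2)]. *)
      have -> : - t = - (2^-1 * t) + - (2^-1 * t) by lra.
      rewrite expRD mulrA ler_piMl ?expR_ge0// expRN ler_pdivrMr ?expR_gt0//
        mul1r.
      apply: le_trans (expR_ge1Dx _).
      have := sqr_ge0 (Num.sqrt t - 1); have := sqr_sqrtr (ltW t0).
      set u := Num.sqrt t; nra.
  rewrite ge0_integralZl_EFin//; last 2 first.
  - by move=> t _; rewrite lee_fin exponential_pdf_ge0.
  - by apply/measurable_EFinP; exact: measurable_exponential_pdf.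
  by rewrite integral_exponential_pdf ?invr_gt0// mule1 ltry.
rewrite /Rintegral fine_gt0// fin andbT.
apply: (@lt_le_trans _ _ (\int[mu]_(t in `[1%R, 2%R]) (expR (- 2))%:E)%E).
  rewrite integral_cst//= lebesgue_measure_itv /= lte_fin ltr1n -EFinB -EFinM.
  by rewrite lte_fin mulr_gt0 ?expR_gt0// subr_gt0 ltr1n.
apply: (@le_trans _ _ (\int[mu]_(t in `[1%R, 2%R]) (g t)%:E)%E).
  apply: ge0_le_integral => //.
  - exact: mg.
  - move=> t; rewrite /= in_itv /= => /andP[t1 t2]; rewrite lee_fin /g.
    apply: (@le_trans _ _ (expR (- t))); first by rewrite ler_expR lerN2.
    by rewrite ler_peMl ?expR_ge0// powR12_sqrt ?(le_trans ler01)// -sqrtr1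
      ler_wsqrtr.
apply: ge0_subset_integral => //.
- exact: mg.
- by move=> t _; rewrite lee_fin.
- by move=> t; rewrite /= !in_itv /= andbT => /andP[t1 _];
    apply: lt_le_trans t1.
Qed.

Lemma damping_const_gt0 (alpha : R) : 0 < alpha < 1 -> 0 < damping_const alpha.
Proof.
move=> /andP[a0 a1]; rewrite /damping_const divr_gt0 ?powR_gt0 ?pi_gt0//.
rewrite mulr_gt0 ?Gamma_fun_3half_gt0// mulr_gt0// sin_gt0_pi//.
by rewrite mulr_gt0 ?pi_gt0//= gtr_pMl ?pi_gt0.
Qed.

End DampingConst.

(** * Resolvents and operator norms *)

Section ResolventFacts.
Context {R : realType} {E : lmodType R[i]}.
Variables (N : E -> R) (T : operator E) (l : R[i]).
Hypothesis hl : resolvent_set N T l.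

Lemma resolventP y :
  dom T (resolvent T l y) /\ l *: resolvent T l y - T (resolvent T l y) = y.
Proof.
have [[_ _ /(_ y Logic.I)[x dx xy]] _] := hl.
pose P := [set x | dom T x /\ l *: x - T x = y].
by have : P (resolvent T l y) by apply: xgetPex; exists x.
Qed.

Lemma resolvent_eq x y : dom T x -> l *: x - T x = y -> resolvent T l y = x.
Proof.
move=> dx xy; have [dr ry] := resolventP y; have [[_ inj _] _] := hl.
by apply: inj; rewrite ?inE//= ry xy.
Qed.

End ResolventFacts.

(** Homogeneity turns a bound on the unit ball into a bound by the norm. *)
Lemma opnorm_bound (R : realType) (E : lmodType R[i]) (N : E -> R) (f : E -> E)
    (K : R) :
  (forall x, 0 <= N x) ->
  (forall (c : R) x, N (c%:C%C *: x) = `|c| * N x) ->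
  (forall (c : R) x, f (c%:C%C *: x) = c%:C%C *: f x) ->
  (opnorm N f <= K%:E)%E -> forall x, N (f x) <= K * N x.
Proof.
move=> N0 NZ fZ hK.
have unit x : N x <= 1 -> N (f x) <= K.
  move=> x1; rewrite -lee_fin; apply: le_trans hK.
  by apply: ereal_sup_ubound; exists x.
move=> x; have [x0|x0] := eqVneq (N x) 0.
  rewrite x0 mulr0 leNgt; apply/negP => fx.
  (* All multiples of [x] lie in the unit ball; this one has an image of norm
     larger than [K]. *)
  have := unit (((`|K| + 1) / N (f x))%:C%C *: x).
  rewrite NZ x0 mulr0 => /(_ ler01); rewrite fZ NZ ger0_norm; last first.
    by rewrite divr_ge0// addr_ge0.
  rewrite divfK ?gt_eqF// => h; have := ler_norm K; lra.
have xp : 0 < N x by rewrite lt_def x0 N0.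
have := unit ((N x)^-1%:C%C *: x).
rewrite NZ ger0_norm ?invr_ge0// mulVf// lexx => /(_ isT).
by rewrite fZ NZ ger0_norm ?invr_ge0// mulrC ler_pdivrMr.
Qed.

(** * The space of finite energy and its dual *)

Section HalfScaleFacts.
Context {R : realType} {H : hilbertSpace R} (S : linearOperator H).
Local Notation H12 := (halfSpace S).
Implicit Types (u v w : H12).

Lemma half_dom u : dom S (half_val u).
Proof. by have := half_valP u; rewrite inE. Qed.

Lemma half_val_to_half h : dom S h -> half_val (to_half S h) = h.
Proof. by move=> dh; rewrite /to_half insubdK// inE. Qed.

Lemma half_valD u v : half_val (u + v) = half_val u + half_val v.
Proof. by []. Qed.

Lemma half_valN u : half_val (- u) = - half_val u.
Proof. by []. Qed.

Lemma half_valZ c u : half_val (c *: u) = c *: half_val u.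
Proof. by []. Qed.

Lemma half_val_inj : injective (@half_val R H S).
Proof. exact: val_inj. Qed.

Lemma to_halfZ c h : dom S h -> to_half S (c *: h) = c *: to_half S h.
Proof.
move=> dh; apply: half_val_inj; rewrite half_valZ half_val_to_half//.
rewrite half_val_to_half//.
have := half_dom (c *: to_half S h); by rewrite half_valZ half_val_to_half.
Qed.

Lemma half_opD u v :
  S (half_val (u + v)) = S (half_val u) + S (half_val v).
Proof.
have := linop_lin 1 (half_dom u) (half_dom v).
by rewrite !scale1r.
Qed.

Lemma half_opZ c u : S (half_val (c *: u)) = c *: S (half_val u).
Proof.
have := linop_lin (-1) (half_dom u) (half_dom u).
rewrite !scaleN1r !addNr => S0.
have := linop_lin c (half_dom u) (half_dom 0).
by rewrite [half_val 0]/(half_val 0) S0 !addr0.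
Qed.

Lemma half_opN u : S (half_val (- u)) = - S (half_val u).
Proof. by rewrite -scaleN1r half_opZ scaleN1r. Qed.

(** In the resolvent equation the velocity [v] is determined by [u] and [f];
    this gives its image under the square root of [A]. *)
Lemma half_op_velocity (c : R[i]) u (f : H12) (v : H) : dom S v ->
  c *: half_val u - v = half_val f ->
  S v = c *: S (half_val u) - S (half_val f).
Proof.
move=> dv e; rewrite -[in LHS](half_val_to_half dv).
have -> : to_half S v = c *: u - f.
  apply: half_val_inj; rewrite half_val_to_half// half_valD half_valZ.
  by rewrite half_valN -e opprB addrC subrK.
by rewrite half_opD half_opZ half_opN.
Qed.

Hypothesis denseS : dense (dom S).

(** A vector orthogonal to a dense subspace vanishes; it makes [of_pivot] a
    genuine inverse of the embedding of [H]. *)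
Lemma pivot_inj : injective (@pivot R H S).
Proof.
move=> h h' e; apply/eqP; rewrite -subr_eq0; apply/negPn/negP => d0.
set d := h - h' in d0.
have dp : 0 < `|d| by rewrite normr_gt0.
(* An element [z] of the domain is orthogonal to [d], so it is at least as far
   from [d] as 0 is. *)
have [z [zd zS]] : ball d `|d| `&` dom S !=set0.
  apply: denseS; last exact: ball_open.
  by exists d; exact: ballxx.
have dz : rdot d z = 0.
  have := congr1 (fun F => F (to_half S z)) e.
  rewrite /pivot half_val_to_half// => e2.
  by rewrite rdotBl /rdot e2 subrr.
move: zd; rewrite -ball_normE /= !rnormE ltcR => lt.
have := sqr_rnormD d (- z); rewrite rdotNr dz rnormN => e3.
have : rnorm (d - z) ^+ 2 < rnorm d ^+ 2.
  by rewrite ltr_pXn2r// nnegrE rnorm_ge0.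
by rewrite e3; have := sqr_ge0 (rnorm z); lra.
Qed.

Lemma pivotK (l : H12 -> R[i]) :
  (exists h, pivot h = l) -> pivot (of_pivot l) = l.
Proof. 
by move=> [h hl]; exact: (@xgetPex _ 0 [set h | pivot h = l] (ex_intro _ h hl)).
Qed.

Lemma of_pivot_eq h (l : H12 -> R[i]) : pivot h = l -> of_pivot l = h.
Proof. by move=> e; apply: pivot_inj; rewrite pivotK//; exists h. Qed.

End HalfScaleFacts.

(** * The operator calA0 *)

Section StaticDamping.
Context {R : realType} {H U : hilbertSpace R} (S : linearOperator H).
Variables (B : boundedToDual U S) (Bs : halfSpace S -> U).
Hypothesis hBs : is_adjoint B Bs.
Hypothesis denseS : dense (dom S).
Local Notation H12 := (halfSpace S).
Implicit Types (x y : calH0 S) (u w : H12).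

(** The squared norm of [calH0]. *)
Definition energy0 x : R := rnorm (S (half_val x.1)) ^+ 2 + rnorm x.2 ^+ 2.

Lemma energy0_ge0 x : 0 <= energy0 x.
Proof. by rewrite addr_ge0 ?sqr_ge0. Qed.

Lemma calH0_normE x : calH0_norm S x = Num.sqrt (energy0 x).
Proof.
rewrite /calH0_norm /calH0_dotp complex_Re_add; congr Num.sqrt.
by rewrite /energy0 -!rdotxx.
Qed.

Lemma calH0_norm_ge0 x : 0 <= calH0_norm S x.
Proof. by rewrite calH0_normE sqrtr_ge0. Qed.

Lemma sqr_calH0_norm x : calH0_norm S x ^+ 2 = energy0 x.
Proof. by rewrite calH0_normE sqr_sqrtr// energy0_ge0. Qed.

Lemma energy0Z (c : R[i]) x :
  energy0 (c *: x) = (complex.Re c ^+ 2 + complex.Im c ^+ 2) * energy0 x.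
Proof. by rewrite /energy0 /= half_opZ !sqr_rnormZ mulrDr. Qed.

Lemma energy0D_le x y : energy0 (x + y) <= 2 * energy0 x + 2 * energy0 y.
Proof.
rewrite /energy0 /= half_opD.
have := sqr_rnormD_le (S (half_val x.1)) (S (half_val y.1)).
by have := sqr_rnormD_le x.2 y.2; lra.
Qed.

Lemma calH0_normZ (c : R) x :
  calH0_norm S (c%:C%C *: x) = `|c| * calH0_norm S x.
Proof.
by rewrite !calH0_normE energy0Z /= expr0n addr0 sqrtrM ?sqr_ge0// sqrtr_sqr.
Qed.

Lemma rdot_adjoint z w : complex.Re (B z w) = rdot z (Bs w).
Proof. by rewrite /rdot hBs. Qed.

(** Linearity of the adjoint comes from the conjugate linearity of the
    functionals [B z]. *)
Lemma adjointZ (c : R[i]) w : Bs (c *: w) = c *: Bs w.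
Proof.
apply/eqP; rewrite -subr_eq0; apply/eqP; set d := (X in X = 0).
have e z : dotp U z d = 0.
  rewrite /d linearBr /= linearZr_LR /= -!hBs.
  have [lin _] := bdual_range B z.
  have B0 : B z 0 = 0.
    have := lin (-1) 0 0; rewrite scaler0 addr0 rmorphN1 mulN1r => h.
    by rewrite h addNr.
  by have := lin c w 0; rewrite !addr0 B0 addr0 => ->; rewrite subrr.
by apply: rnorm_eq0; apply/eqP; rewrite -sqrf_eq0 -rdotxx /rdot e.
Qed.

(** Needed for the homogeneity of the resolvent, without which an operator
    norm bounds the resolvent on the unit ball only. *)
Lemma calA0_scale (c : R[i]) x : dom (calA0 B Bs) x ->
  dom (calA0 B Bs) (c *: x) /\ calA0 B Bs (c *: x) = c *: calA0 B Bs x.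
Proof.
case: x => u v [/= dv [h hh]].
have dcv : dom S (c *: v).
  by have := half_dom (c *: to_half S v); rewrite half_valZ half_val_to_half.
have hc : pivot (c *: h) = stress0 B Bs (c *: u) (c *: v).
  apply/funext => w; rewrite /pivot linearZl_LR /=.
  have := congr1 (fun F => F w) hh; rewrite /pivot => ->.
  rewrite /stress0 /ext_op half_opZ linearZl_LR /= to_halfZ// adjointZ.
  have := bdual_lin B c (Bs (to_half S v)) 0 w.
  have B0 : B 0 w = 0 by rewrite hBs linear0l.
  by rewrite addr0 B0 addr0 => ->; rewrite mulrDr.
split; first by split => //; exists (c *: h).
rewrite /= (of_pivot_eq denseS hc) (of_pivot_eq denseS hh) to_halfZ//.
by congr pair; rewrite scalerN.
Qed.

Lemma calA0_resolventZ (l : R[i]) :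
  resolvent_set (calH0_norm S) (calA0 B Bs) l -> forall (c : R[i]) y,
  resolvent (calA0 B Bs) l (c *: y) = c *: resolvent (calA0 B Bs) l y.
Proof.
move=> hl c y; have [dr er] := resolventP hl y.
have [dc ec] := calA0_scale c dr.
apply: (resolvent_eq hl dc).
by rewrite ec -{3}er scalerBr !scalerA mulrC.
Qed.

(** The resolvent equation tested against the elements of the form domain,
    which avoids any mention of the dual space. *)
Lemma calA0_weak (a : R) y (x := resolvent (calA0 B Bs) (0 +i* a)%C y) :
  resolvent_set (calH0_norm S) (calA0 B Bs) (0 +i* a)%C ->
  [/\ dom S x.2,
      (0 +i* a)%C *: half_val x.1 - x.2 = half_val y.1 &
      forall w, rdot ((0 +i* a)%C *: x.2) (half_val w)
        + rdot (S (half_val x.1)) (S (half_val w))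
        + rdot (Bs (to_half S x.2)) (Bs w) = rdot y.2 (half_val w)].
Proof.
move=> hl; have := resolventP hl y; rewrite -/x.
case: x => p q [[/= dq hp]] eq.
split => //.
  have <- : half_val ((0 +i* a)%C *: p - to_half S q) = half_val y.1.
    by rewrite -eq.
  by rewrite half_valD half_valZ half_valN half_val_to_half.
move=> w.
have /(congr1 snd) /= <- := eq.
rewrite opprK rdotDl -addrA; congr (_ + _).
have -> : rdot (of_pivot (stress0 B Bs p q)) (half_val w) =
    complex.Re (stress0 B Bs p q w) by rewrite -[in RHS](pivotK hp).
by rewrite /stress0 complex_Re_add rdot_adjoint.
Qed.

End StaticDamping.

(** * A source in the dual space *)

Section DualEstimate.
Context {R : realType} {H U : hilbertSpace R} (S : linearOperator H).
Variables (B : boundedToDual U S) (Bs : halfSpace S -> U).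
Hypothesis hBs : is_adjoint B Bs.
Local Notation H12 := (halfSpace S).
Local Notation res0 a := (resolvent (calA0 B Bs) (0 +i* a)%C).
Local Notation in_resolvent a :=
  (resolvent_set (calH0_norm S) (calA0 B Bs) (0 +i* a)%C).

(** [(u, v)] solves the resolvent equation of [calA0] at [a] with an extra
    source [B k]. The solution [(p, q)] at [- a] with data [(- u, v)] plays
    the role of the adjoint state. Subtracting the two equations, each tested
    with the velocity of the other, leaves [|(u, v)|^2 = <g, q> - <S p, S f> +
    <k, B^* q>]; testing the second one with [q] leaves [|B^* q|^2 = <v, q> -
    <S p, S u>]. *)
Lemma dual_estimate (a m : R) (u f : H12) (v g : H) (k : U) :
  in_resolvent (- a) -> 0 < m ->
  (forall y, energy0 (res0 (- a) y) <= m ^+ 2 * energy0 y) ->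
  dom S v -> (0 +i* a)%C *: half_val u - v = half_val f ->
  (forall w, rdot ((0 +i* a)%C *: v) (half_val w)
     + rdot (S (half_val u)) (S (half_val w))
     + rdot (Bs (to_half S v)) (Bs w) = rdot g (half_val w) + rdot k (Bs w)) ->
  energy0 ((u, v) : calH0 S) <=
    8 * m ^+ 2 * energy0 ((f, g) : calH0 S) + 16 * m * rnorm k ^+ 2.
Proof.
move=> hl m0 hm dv e1 e2.
pose y : calH0 S := (- u, v).
have [] := calA0_weak hBs y hl; have := hm y.
case: (res0 (- a) y) => p q /=.
set J := (0 +i* a)%C in e1 e2 *.
have -> : (0 +i* (- a))%C = - J by rewrite /J; apply/eqP;
  rewrite eq_complex /= oppr0 !eqxx.
move=> le dq eq1 eq2.
have SqE : S q = - (J *: S (half_val p)) + S (half_val u).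
  by rewrite (half_op_velocity (f := - u) dq eq1) half_opN opprK scaleNr.
have SvE := half_op_velocity dv e1.
have A := eq2 (to_half S v); have C := eq2 (to_half S q).
have Bq := e2 (to_half S q).
rewrite half_val_to_half// in A; rewrite half_val_to_half// in C.
rewrite half_val_to_half// in Bq.
rewrite SvE in A; rewrite SqE in C Bq.
rewrite scaleNr !rdotBr rdotNl rdotxx in A.
rewrite scaleNr !rdotDr !rdotNr !rdotNl rdot_skew0 !rdotxx in C.
rewrite !rdotDr !rdotNr !rdotxx in Bq.
have s1 : rdot (J *: v) q = - rdot (J *: q) v by rewrite rdot_skew rdotC.
have s2 : rdot (S (half_val u)) (J *: S (half_val p)) =
   - rdot (S (half_val p)) (J *: S (half_val u)).
  by rewrite rdotC rdot_skew.
have s3 : rdot (S (half_val p)) (J *: S (half_val p)) = 0.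
  by rewrite rdotC rdot_skew0.
rewrite s1 s2 [rdot (Bs _) (Bs _)]rdotC in Bq; rewrite s3 in C.
move: le; rewrite /energy0 /= half_opN rnormN.
set P := S (half_val p) in A C Bq *; set Uu := S (half_val u) in A C Bq *.
set F := S (half_val f) in A *; set bq := Bs (to_half S q) in A C Bq.
set E := rnorm Uu ^+ 2 + rnorm v ^+ 2 => le.
have E1 : E = rdot g q + rdot k bq - rdot P F.
  rewrite /E; lra.
have E2 : rnorm bq ^+ 2 = rdot v q - rdot P Uu by lra.
have m2 : 0 < m ^+ 2 by rewrite exprn_gt0.
(* These two parameters make each of the terms with [p], [q] and [B^* q] at
   most a quarter of [E]. *)
have s0 : 0 < 4 * m ^+ 2 by rewrite mulr_gt0.
have r0 : 0 < 8 * m by rewrite mulr_gt0.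
have y1 := rdot_young g q s0.
have y2 := rdot_young k bq r0.
have y3 := rdot_young (- F) P s0; rewrite rdotNl rnormN rdotC in y3.
have y4 := rdot_young v q m0.
have y5 := rdot_young (- Uu) P m0; rewrite rdotNl rnormN rdotC in y5.
have E0 : 0 <= E by rewrite addr_ge0 ?sqr_ge0.
have l1 : (4 * m ^+ 2)^-1 * (rnorm P ^+ 2 + rnorm q ^+ 2) <= E / 4.
  by rewrite mulrC ler_pdivrMr//; apply: le_trans le _; lra.
have l2 : m^-1 * (rnorm P ^+ 2 + rnorm q ^+ 2) <= m * E.
  by rewrite mulrC ler_pdivrMr//; apply: le_trans le _; rewrite expr2 mulrAC.
have l3 : (8 * m)^-1 * rnorm bq ^+ 2 <= E / 4.
  by rewrite mulrC ler_pdivrMr// E2; rewrite /E in l2 *; lra.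
lra.
Qed.

End DualEstimate.

(** * A bound on the resolvent of calA0 valid at all frequencies *)

Section UniformBound.
Context {R : realType} {H U : hilbertSpace R} (S : linearOperator H).
Variables (B : boundedToDual U S) (Bs : halfSpace S -> U).
Hypothesis hBs : is_adjoint B Bs.
Hypothesis denseS : dense (dom S).
Local Notation res0 a := (resolvent (calA0 B Bs) (0 +i* a)%C).
Local Notation in_resolvent a :=
  (resolvent_set (calH0_norm S) (calA0 B Bs) (0 +i* a)%C).

Lemma calH0_norm_le_energy0 (x y : calH0 S) K :
  0 <= K -> calH0_norm S x <= K * calH0_norm S y ->
  energy0 x <= K ^+ 2 * energy0 y.
Proof.
move=> K0 h; rewrite -!sqr_calH0_norm -exprMn ler_sqr// nnegrE ?mulr_ge0//;
  exact: calH0_norm_ge0.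
Qed.

Lemma opnorm_ge0 (f : calH0 S -> calH0 S) : (0 <= opnorm (calH0_norm S) f)%E.
Proof.
apply: (@le_trans _ _ (calH0_norm S (f 0))%:E).
  by rewrite lee_fin calH0_norm_ge0.
apply: ereal_sup_ubound; exists 0 => //=.
by rewrite -(scale0r 0) (calH0_normZ 0) normr0 mul0r.
Qed.

Lemma resolvent0_bounded (a : R) : in_resolvent a ->
  exists2 K, 0 <= K & forall y, energy0 (res0 a y) <= K * energy0 y.
Proof.
move=> hl; have [_ fin] := hl.
pose K := fine (opnorm (calH0_norm S) (res0 a)).
exists (K ^+ 2); first exact: sqr_ge0.
move=> y; apply: calH0_norm_le_energy0; first by rewrite fine_ge0// opnorm_ge0.
apply: opnorm_bound => //.
- exact: calH0_norm_ge0.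
- exact: calH0_normZ.
- by move=> c x; apply: calA0_resolventZ.
- by rewrite fineK// ge0_fin_numE// opnorm_ge0.
Qed.

(** [x = R(b) y] solves [x = R(a) (y + i (a - b) x)], and the part with [x] is
    absorbed when [a] and [b] are close. *)
Lemma resolvent0_locally_bounded (a b K : R) :
  in_resolvent a -> in_resolvent b ->
  (forall y, energy0 (res0 a y) <= K * energy0 y) -> 0 <= K ->
  4 * K * (b - a) ^+ 2 <= 1 ->
  forall y, energy0 (res0 b y) <= 4 * K * energy0 y.
Proof.
move=> ha hb hK K0 small y.
have [dx ex] := resolventP hb y; set x := res0 b y in dx ex *.
have xE : res0 a (y + (0 +i* (a - b))%C *: x) = x.
  apply: (resolvent_eq ha dx); rewrite -ex addrAC -scalerDl; congr (_ *: _ - _).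
  by apply/eqP; rewrite eq_complex /= addr0 eqxx /= addrC subrK.
have := hK (y + (0 +i* (a - b))%C *: x); rewrite xE => h.
have := energy0D_le y ((0 +i* (a - b))%C *: x).
rewrite energy0Z /= expr0n add0r => h2.
have h3 : energy0 x <= K * (2 * energy0 y + 2 * ((a - b) ^+ 2 * energy0 x)).
  by apply: le_trans h _; rewrite ler_wpM2l.
have : (4 * K * (b - a) ^+ 2) * energy0 x <= 1 * energy0 x.
  by rewrite ler_wpM2r// energy0_ge0.
have -> : (b - a) ^+ 2 = (a - b) ^+ 2 by rewrite -sqrrN opprB.
move: h3; set e := energy0 x; set d := (a - b) ^+ 2; lra.
Qed.

(** A local bound at each point of a segment gives a common one by
    compactness. *)
Lemma resolvent0_compact_bounded (r : R) : (forall a, in_resolvent a) ->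
  exists2 K, 0 <= K &
    forall a, `|a| <= r -> forall y, energy0 (res0 a y) <= K * energy0 y.
Proof.
move=> hl.
pose P (K a : R) := forall y, energy0 (res0 a y) <= K * energy0 y.
have Pmono K K' a : K <= K' -> P K a -> P K' a.
  by move=> KK' h y; apply: le_trans (h y) _; rewrite ler_wpM2r// energy0_ge0.
have /compact_near_coveringP/(_ _ (+oo : set_system R) P) := @segment_compact R
  (- r) r.
have : forall a, `[- r, r]%classic a -> \forall a' \near a & K \near +oo, P K
  a'.
  move=> a _; have [K K0 hK] := resolvent0_bounded (hl a).
  have K4 : 0 <= 4 * K by rewrite mulr_ge0.
  (* A neighbourhood of [a] and a bound that serves all of it. *)
  exists ([set a' | 4 * K * (a' - a) ^+ 2 <= 1], [set K' | 4 * K <= K']).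
    split => /=; last exact: (nbhs_pinfty_ge (num_real _)).
    have d0 : 0 < (4 * K + 1)^-1 by rewrite invr_gt0 ltr_wpDl.
    exists (4 * K + 1)^-1 => // a' /=; rewrite distrC => lt.
    have d1 : `|a' - a| < 1.
      by apply: lt_le_trans lt _; rewrite invf_le1 ?ltr_wpDl// lerDr.
    rewrite -real_normK ?num_real//.
    have : `|a' - a| * (4 * K + 1) < 1 by rewrite -ltr_pdivlMr ?ltr_wpDl//
      div1r.
    have := normr_ge0 (a' - a); move: d1; set d := `|a' - a| => d1 dge0 dK.
    have : 4 * K * d ^+ 2 <= 4 * K * d.
      by rewrite ler_wpM2l// expr2 ler_piMl// ltW.
    lra.
  move=> [a' K'] /= [h1 h2]; apply: Pmono h2 _.
  exact: (resolvent0_locally_bounded (hl a) (hl a')).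
move=> h /(_ _ h) [K [_ hK]].
exists (`|K| + 1); first by rewrite addr_ge0.
move=> a ar; apply: hK; first by have := ler_norm K; lra.
by rewrite /= in_itv /= -ler_norml.
Qed.

(** For frequencies beyond the threshold [r] of the upper limit the bound is
    the hypothesis. Below it, the bound on the segment [[- r, r]] is enough,
    since [M] is bounded below by [M 1 > 0] on the frequencies at least 1. *)
Lemma resolvent0_uniform_bound (M : R -> R) :
  {in `[0, +oo[ &, {homo M : x y / x <= y}} ->
  (forall x, 0 < x -> 0 < M x) ->
  (forall a, in_resolvent a) ->
  (limf_esup (fun a : R =>
      opnorm (calH0_norm S) (fun y => ((M `|a|)^-1)%:C%C *: res0 a y)%R)
    (abs_infty R) < +oo)%E ->
  exists2 K, 0 < K &
    forall a, 1 <= `|a| -> 1 <= K * M `|a| /\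
      forall y, energy0 (res0 a y) <= (K * M `|a|) ^+ 2 * energy0 y.
Proof.
move=> hM M0 hl /ereal_inf_lt[_ [V [r _ rV] <-]].
set s := ereal_sup _ => sfin.
have M1 : 0 < M 1 by exact: M0.
have M1a a : 1 <= a -> M 1 <= M a.
  by move=> a1; apply: hM => //; rewrite in_itv /= andbT// (le_trans ler01).
have s0 : (0 <= s)%E.
  pose a0 := `|r| + 1.
  apply: (@le_trans _ _ (opnorm (calH0_norm S)
    (fun y => ((M `|a0|)^-1)%:C%C *: res0 a0 y)%R)); first exact: opnorm_ge0.
  apply: ereal_sup_ubound; exists a0 => //; apply: rV => /=.
  by rewrite ger0_norm ?addr_ge0// /a0; have := ler_norm r; lra.
have sE : s = (fine s)%:E by rewrite fineK// ge0_fin_numE.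
have s0' : 0 <= fine s by rewrite fine_ge0.
have [K2 K20 hK2] := resolvent0_compact_bounded r hl.
(* The first term serves large frequencies; the second one serves the others
   and makes [K * M] at least 1. *)
pose K := fine s + (Num.sqrt K2 + 1) / M 1.
have q0 : 0 <= (Num.sqrt K2 + 1) / M 1.
  by rewrite divr_ge0 ?addr_ge0 ?sqrtr_ge0 ?(ltW M1).
have K1 : (Num.sqrt K2 + 1) / M 1 <= K by rewrite /K lerDr.
have KM1 (a : R) : 1 <= `|a| -> Num.sqrt K2 + 1 <= K * M `|a|.
  move=> a1; apply: (@le_trans _ _ (K * M 1)); first by rewrite -ler_pdivrMr.
  by rewrite ler_wpM2l ?M1a// addr_ge0.
exists K.
  by apply: lt_le_trans K1; rewrite divr_gt0// ltr_wpDl ?sqrtr_ge0.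
move=> a a1; have h1 := KM1 a a1; split.
  by apply: le_trans h1; rewrite lerDr sqrtr_ge0.
move=> y; have Ma : 0 < M `|a| by apply: M0; apply: lt_le_trans a1.
have KMa0 : 0 <= K * M `|a| by rewrite mulr_ge0 ?(ltW Ma)// addr_ge0.
have [ar|ra] := leP `|a| r.
  apply: le_trans (hK2 a ar y) _; rewrite ler_wpM2r ?energy0_ge0//.
  rewrite -[leLHS](sqr_sqrtr K20) ler_sqr ?nnegrE ?sqrtr_ge0//.
  by apply: le_trans h1; rewrite lerDl.
apply: calH0_norm_le_energy0 => //.
have : (opnorm (calH0_norm S) (fun y => ((M `|a|)^-1)%:C%C *: res0 a y)%R <=
  (fine s)%:E)%E.
  by rewrite -sE; apply: ereal_sup_ubound; exists a => //; apply: rV.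
move=> /(opnorm_bound (@calH0_norm_ge0 _ _ S) (@calH0_normZ _ _ S)).
have lin (c : R) (x : calH0 S) : ((M `|a|)^-1)%:C%C *: res0 a (c%:C%C *: x) =
    c%:C%C *: (((M `|a|)^-1)%:C%C *: res0 a x).
  by rewrite calA0_resolventZ// !scalerA mulrC.
move=> /(_ lin y); rewrite calH0_normZ ger0_norm ?invr_ge0 ?(ltW Ma)//.
rewrite mulrC ler_pdivrMr// => h.
apply: le_trans h _; rewrite mulrAC ler_wpM2r ?calH0_norm_ge0//.
by rewrite ler_wpM2r ?(ltW Ma)// lerDl.
Qed.

End UniformBound.

(** * The diffusion equation *)

Section FractionalPart.
Context {R : realType} {U : hilbertSpace R}.
Local Notation mu := (@lebesgue_measure R).
Local Notation integrableT f := (mu.-integrable setT (fun t : R => (f t)%:E)).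
Implicit Types (f g : R -> U).

Lemma L2_function_integrable f : L2_function f ->
  integrableT (fun t => rnorm (f t) ^+ 2).
Proof.
move=> [mf fin]; apply/integrableP; split.
  by apply/measurable_EFinP; apply: (measurable_funX 2);
    exact: measurable_rnorm.
under eq_integral do rewrite gee0_abs ?lee_fin ?sqr_ge0//.
exact: fin.
Qed.

Lemma integrableT_le (f g : R -> R) : measurable_fun setT f ->
  (forall t, `|f t| <= g t) -> integrableT g -> integrableT f.
Proof.
move=> mf fg; apply: le_integrable => //.
  exact/measurable_EFinP.
move=> t _; rewrite !abse_EFin lee_fin.
by apply: le_trans (fg t) _; exact: ler_norm.
Qed.

Lemma integrableTD (f g : R -> R) : integrableT f -> integrableT g ->
  integrableT (fun t => f t + g t).
Proof. by move=> i j; have := integrableD measurableT i j. Qed.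

Lemma integrableTZ (c : R) (f : R -> R) : integrableT f ->
  integrableT (fun t => c * f t).
Proof. by move=> i; have := integrableZl measurableT c i. Qed.

Lemma RintegralZ (c : R) (f : R -> R) : integrableT f ->
  \int[mu]_t (c * f t) = c * \int[mu]_t f t.
Proof. by move=> i; rewrite RintegralZl. Qed.

Lemma RintegralDT (f g : R -> R) : integrableT f -> integrableT g ->
  \int[mu]_t (f t + g t) = \int[mu]_t f t + \int[mu]_t g t.
Proof. by move=> i j; rewrite RintegralD. Qed.

Lemma RintegralBT (f g : R -> R) : integrableT f -> integrableT g ->
  \int[mu]_t (f t - g t) = \int[mu]_t f t - \int[mu]_t g t.
Proof. by move=> i j; rewrite RintegralB. Qed.

Lemma le_RintegralT (f g : R -> R) : integrableT f -> integrableT g ->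
  (forall t, f t <= g t) -> \int[mu]_t f t <= \int[mu]_t g t.
Proof. by move=> i j fg; apply: le_Rintegral. Qed.

Lemma integrableT_rdot f g : L2_function f -> L2_function g ->
  integrableT (fun t => rdot (f t) (g t)).
Proof.
move=> lf lg; apply: (integrableT_le (g := fun t => rnorm (f t) ^+ 2 + rnorm (g
  t) ^+ 2)).
- by apply: measurable_rdot; [case: lf|case: lg].
- by move=> t; have := normr_rdot_young (f t) (g t) ltr01; rewrite invr1 !mul1r.
- by apply: integrableTD; exact: L2_function_integrable.
Qed.

Lemma Rintegral_rdot_young t f g : 0 < t -> L2_function f -> L2_function g ->
  \int[mu]_x rdot (f x) (g x) <=
  t * \int[mu]_x (rnorm (f x) ^+ 2) + t^-1 * \int[mu]_x (rnorm (g x) ^+ 2).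
Proof.
move=> t0 lf lg.
have iF := L2_function_integrable lf; have iG := L2_function_integrable lg.
rewrite -!RintegralZ// -RintegralDT//; last 2 first.
- exact: integrableTZ.
- exact: integrableTZ.
apply: le_RintegralT.
- exact: integrableT_rdot.
- by apply: integrableTD; exact: integrableTZ.
- by move=> x; exact: rdot_young.
Qed.

Variables (alpha eta omega : R) (phi h : R -> U) (z : U).
Hypotheses (halpha : 0 < alpha < 1) (heta : 0 < eta).
Hypotheses (Lphi : L2_function phi) (Lh : L2_function h)
  (Lxphi : L2_function (fun xi => `|xi|%:C%C *: phi xi)).
Local Notation p := (weight alpha).
Hypothesis phi_eq : forall xi, (0 +i* omega)%C *: phi xi
  + (`|xi| ^+ 2 + eta)%:C%C *: phi xi = h xi + (p xi)%:C%C *: z.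

(** The density of the dissipated energy [D]. *)
Definition dissipation (xi : R) : R := (`|xi| ^+ 2 + eta) * rnorm (phi xi) ^+ 2.

Lemma symbol_gt0 (xi : R) : 0 < `|xi| ^+ 2 + eta.
Proof. by rewrite ltr_wpDl ?sqr_ge0. Qed.

Lemma dissipation_ge0 xi : 0 <= dissipation xi.
Proof. by rewrite mulr_ge0 ?sqr_ge0// ltW// symbol_gt0. Qed.

Lemma integrableT_dissipation : integrableT dissipation.
Proof.
have := integrableTD (L2_function_integrable Lxphi) (integrableTZ eta
  (L2_function_integrable Lphi)).
congr integrable; apply/funext => t; congr EFin; rewrite /dissipation mulrDl;
  congr (_ + _).
by rewrite rnormZr exprMn normr_id.
Qed.

Let wphi (xi : R) : U := (p xi)%:C%C *: phi xi.

Lemma strongly_measurable_wphi : strongly_measurable wphi.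
Proof.
apply: strongly_measurable_scale; last by case: Lphi.
- exact: measurable_weight.
- exact: weight_ge0.
Qed.

(** The symbol is split between the two factors so that the part with [phi] is
    the dissipation, and the other part the density of the weight. *)
Lemma rdot_wphi_le (y : U) s xi : 0 < s ->
  `|rdot (wphi xi) y| <=
  s * dissipation xi + s^-1 * rnorm y ^+ 2 * weight_density alpha eta xi.
Proof.
move=> s0; rewrite /wphi rdotZl -rdotZr.
apply: le_trans (normr_rdot_young _ _ (mulr_gt0 s0 (symbol_gt0 xi))) _.
rewrite rnormZr (ger0_norm (weight_ge0 alpha xi)) exprMn le_eqVlt; apply/orP;
  left.
apply/eqP; rewrite /dissipation /weight_density.
by field; rewrite !gt_eqF// symbol_gt0.
Qed.

Lemma rnorm_wphi_le xi :
  `|rnorm (wphi xi)| <= dissipation xi + weight_density alpha eta xi.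
Proof.
rewrite ger0_norm ?rnorm_ge0// /wphi rnormZr ger0_norm ?weight_ge0//.
have x0 := symbol_gt0 xi.
rewrite -(ler_pM2r x0) mulrDl /weight_density divfK ?gt_eqF// /dissipation.
have := sqr_ge0 ((`|xi| ^+ 2 + eta) * rnorm (phi xi) - p xi).
have := mulr_ge0 (mulr_ge0 (weight_ge0 alpha xi) (rnorm_ge0 (phi xi))) (ltW x0).
set a := `|xi| ^+ 2 + eta; set b := rnorm _; set c := p xi.
by move=> k; rewrite sqrrB; lra.
Qed.

(** The same splitting shows that [p phi] is integrable, hence that its
    Bochner integral exists, even though [p] is not square integrable. *)
Lemma integrableT_rnorm_wphi : integrableT (fun xi => rnorm (wphi xi)).
Proof.
apply: (integrableT_le _ rnorm_wphi_le).
  exact: (measurable_rnorm strongly_measurable_wphi).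
by apply: integrableTD; [exact: integrableT_dissipation|exact:
  integrable_weight_density].
Qed.

Lemma bochner_wphi y :
  rdot (bochner_integral wphi) y = \int[mu]_xi rdot (wphi xi) y.
Proof.
by apply: bochner_rdot; [exact: strongly_measurable_wphi|exact:
  integrableT_rnorm_wphi].
Qed.

Lemma integrableT_rdot_wphi y : integrableT (fun xi => rdot (wphi xi) y).
Proof.
by apply: integrable_rdot_cst; [exact: strongly_measurable_wphi|exact:
  integrableT_rnorm_wphi].
Qed.

(** Test the diffusion equation with [phi]: the term with [i omega] has no
    real part. *)
Lemma bochner_wphi_energy :
  rdot (bochner_integral wphi) z =
    \int[mu]_xi dissipation xi - \int[mu]_xi rdot (phi xi) (h xi).
Proof.
rewrite bochner_wphi -RintegralBT; first last.
- exact: integrableT_rdot.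
- exact: integrableT_dissipation.
congr Rintegral; apply/funext => xi; rewrite /wphi rdotZl -rdotZr.
have -> : (p xi)%:C%C *: z = (0 +i* omega)%C *: phi xi
  + (`|xi| ^+ 2 + eta)%:C%C *: phi xi - h xi by rewrite phi_eq addrC addKr.
by rewrite rdotBr rdotDr rdotZr rdotxx [rdot _ (_ *: _)]rdotC rdot_skew0 add0r.
Qed.

(** The Cauchy-Schwarz inequality for the product of [p / sqrt (xi^2 + eta)]
    and [sqrt (xi^2 + eta) phi]. *)
Lemma bochner_wphi_bound (Q := \int[mu]_xi weight_density alpha eta xi) :
  rnorm (bochner_integral wphi) ^+ 2 <=
  2 * (2 * Q + 1) * \int[mu]_xi dissipation xi.
Proof.
set I := bochner_integral wphi.
have iQ := integrable_weight_density halpha heta.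
have Q0 : 0 <= Q.
  by apply: Rintegral_ge0 => xi _; exact: weight_density_ge0.
(* With this parameter the term with [I] on the right is at most half of the
   left-hand side. *)
have s0 : 0 < 2 * Q + 1 by rewrite ltr_wpDl ?mulr_ge0.
have : rdot I I <= \int[mu]_xi ((2 * Q + 1) * dissipation xi +
    (2 * Q + 1)^-1 * rnorm I ^+ 2 * weight_density alpha eta xi).
  rewrite {1}/I bochner_wphi; apply: le_RintegralT.
  - exact: integrableT_rdot_wphi.
  - by apply: integrableTD; apply: integrableTZ => //;
      exact: integrableT_dissipation.
  - by move=> xi; apply: le_trans (ler_norm _) _; exact: rdot_wphi_le.
rewrite rdotxx RintegralDT; first last.
- exact: integrableTZ.
- by apply: integrableTZ; exact: integrableT_dissipation.
rewrite !RintegralZ//; last exact: integrableT_dissipation.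
rewrite -/Q; set D := (\int[mu]_xi dissipation xi).
have : (2 * Q + 1)^-1 * rnorm I ^+ 2 * Q <= rnorm I ^+ 2 / 2.
  rewrite -mulrA mulrC ler_pdivrMr//.
  have := sqr_ge0 (rnorm I); set n := _ ^+ 2; nra.
lra.
Qed.

End FractionalPart.

(** * The trace B^* v seen through the diffusion equation *)

Section TraceBound.
Context {R : realType} {U : hilbertSpace R}.
Local Notation mu := (@lebesgue_measure R).
Local Notation integrableT f := (mu.-integrable setT (fun t : R => (f t)%:E)).

(** On a dyadic interval a power with exponent at least -1 loses at most a
    factor 2. *)
Lemma powR_half_le (r x e : R) : 0 < r -> r <= x <= 2 * r -> -1 <= e ->
  r `^ e / 2 <= x `^ e.
Proof.
move=> r0 /andP[rx xr] e1; have x0 := lt_le_trans r0 rx.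
have [e0|e0] := leP 0 e.
  apply: (@le_trans _ _ (r `^ e)).
    by rewrite ler_pdivrMr// ler_peMr ?powR_ge0// ler1n.
  by apply: ge0_ler_powR; rewrite ?nnegrE ?(ltW r0) ?(ltW x0).
have e0' : 0 <= - e by rewrite oppr_ge0 ltW.
apply: (@le_trans _ _ ((2 * r) `^ e)).
  rewrite powRM ?(ltW r0)// mulrC ler_wpM2r ?powR_ge0//.
  rewrite -[leLHS]powR_inv1//.
  by apply: ler_powR; rewrite ?ler1n.
rewrite -(opprK e); set f := - e in e0' *;
  rewrite !(powRN _ f) lef_pV2 ?posrE ?powR_gt0 ?mulr_gt0//.
by apply: ge0_ler_powR; rewrite ?nnegrE ?(ltW x0) ?mulr_ge0 ?(ltW r0).
Qed.

Variables (alpha eta omega : R) (phi h : R -> U) (z : U).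
Hypotheses (halpha : 0 < alpha < 1) (heta : 0 < eta) (homega : 1 <= omega).
Hypotheses (Lphi : L2_function phi) (Lh : L2_function h)
  (Lxphi : L2_function (fun xi => `|xi|%:C%C *: phi xi)).
Local Notation p := (weight alpha).
Hypothesis phi_eq : forall xi, (0 +i* omega)%C *: phi xi
  + (`|xi| ^+ 2 + eta)%:C%C *: phi xi = h xi + (p xi)%:C%C *: z.

(** The diffusion equation gives [p z] in terms of [phi] and [h], with a
    symbol of modulus at most a constant times [omega]; one power of [omega]
    is recovered from [omega |phi|^2 <= xi^2 |phi|^2]. *)
Lemma trace_bound_pointwise (r xi : R) : 0 < r -> r ^+ 2 = omega ->
  r <= xi <= 2 * r ->
  rnorm z ^+ 2 * (r `^ (2 * alpha - 1) / 2) <=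
  2 * (1 + (4 + eta) ^+ 2) * omega * dissipation eta phi xi
  + 2 * rnorm (h xi) ^+ 2.
Proof.
move=> r0 rw /andP[rx xr]; have x0 := lt_le_trans r0 rx.
have /andP[a0 a1] := halpha.
apply: (@le_trans _ _ (p xi ^+ 2 * rnorm z ^+ 2)).
  rewrite mulrC ler_wpM2r ?sqr_ge0// sqr_weight gtr0_norm//.
  by apply: powR_half_le => //; [rewrite rx xr|lra].
have -> : p xi ^+ 2 * rnorm z ^+ 2 =
    rnorm (((`|xi| ^+ 2 + eta) +i* omega)%C *: phi xi - h xi) ^+ 2.
  have -> : ((`|xi| ^+ 2 + eta) +i* omega)%C *: phi xi - h xi = (p xi)%:C%C *:
    z.
    rewrite -[RHS](addKr (h xi)) -phi_eq -scalerDl addrC; congr (_ + _ *: _).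
    by apply/eqP; rewrite eq_complex /= add0r addr0 !eqxx.
  by rewrite rnormZr exprMn ger0_norm ?weight_ge0.
apply: le_trans (sqr_rnormD_le _ _) _;
  rewrite rnormN sqr_rnormZ /= /dissipation.
set n := rnorm (phi xi) ^+ 2; have n0 : 0 <= n by exact: sqr_ge0.
rewrite lerD2r gtr0_norm//.
have -> : 2 * (1 + (4 + eta) ^+ 2) * omega * ((xi ^+ 2 + eta) * n) =
  2 * ((1 + (4 + eta) ^+ 2) * omega * (xi ^+ 2 + eta) * n) by ring.
rewrite ler_wpM2l// ler_wpM2r//.
have x1 : omega <= xi ^+ 2 by rewrite -rw ler_sqr// nnegrE ltW.
have x2 : xi ^+ 2 <= 4 * omega.
  have -> : 4 * omega = (2 * r) ^+ 2 by rewrite exprMn rw; ring.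
  by rewrite ler_sqr// nnegrE ?mulr_ge0 ?(ltW r0) ?(ltW x0).
set s := xi ^+ 2 in x1 x2 *.
have s1 : s + eta <= (4 + eta) * omega.
  have : eta * 1 <= eta * omega by rewrite ler_wpM2l// ltW.
  lra.
have w0 : 0 < omega by exact: lt_le_trans homega.
have s2 : (s + eta) ^+ 2 <= ((4 + eta) * omega) ^+ 2.
  by rewrite ler_sqr// nnegrE ?mulr_ge0 ?addr_ge0 ?(ltW w0) ?(ltW heta)
    ?sqr_ge0.
apply: (@le_trans _ _ ((1 + (4 + eta) ^+ 2) * omega * omega)).
  by move: s2; rewrite exprMn; lra.
rewrite ler_wpM2l// ?mulr_ge0 ?addr_ge0 ?sqr_ge0 ?(ltW w0)//.
by apply: le_trans x1 _; rewrite lerDl ltW.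
Qed.

(** Integrate the pointwise bound over [[r, 2 r]] with [r = sqrt omega], where
    the left-hand side gains [r * r^(2 alpha - 1) = omega^alpha]. *)
Lemma trace_bound :
  rnorm z ^+ 2 <= 4 * (1 + (4 + eta) ^+ 2) * omega `^ (1 - alpha) *
    (\int[mu]_xi dissipation eta phi xi + \int[mu]_xi (rnorm (h xi) ^+ 2)).
Proof.
have w0 : 0 < omega by exact: lt_le_trans homega.
pose r := omega `^ (2^-1); have r0 : 0 < r by exact: powR_gt0.
have rw : r ^+ 2 = omega.
  by rewrite -powR_mulrn ?powR_ge0// -powRrM mulVf// powRr1// ltW.
have ra : r `^ (2 * alpha - 1) * r = omega `^ alpha.
  rewrite /r -powRrM -powRD; last by rewrite (gt_eqF w0) implybT.
  by congr (_ `^ _); field.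
have wa : omega `^ (1 - alpha) * omega `^ alpha = omega.
  rewrite -powRD; last by rewrite (gt_eqF w0) implybT.
  by rewrite subrK powRr1// ltW.
pose A := `[r, 2 * r]%classic : set R.
have muA : mu A = r%:E.
  rewrite lebesgue_measure_itv /= lte_fin ltr_pMl// ltr1n -EFinB.
  by congr EFin; ring.
have iA : integrableT (\1_A).
  by apply: integrable_indic_lty; [exact: measurable_itv|rewrite muA ltry].
have IA : \int[mu]_t (\1_A t) = r.
  by rewrite /Rintegral integral_indicT ?muA//; exact: measurable_itv.
pose c := rnorm z ^+ 2 * (r `^ (2 * alpha - 1) / 2).
pose c1 := 1 + (4 + eta) ^+ 2.
have c1p : 1 <= c1 by rewrite lerDl sqr_ge0.
have iD := integrableT_dissipation eta Lphi Lxphi;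
  have iH := L2_function_integrable Lh.
have D0 : 0 <= \int[mu]_xi dissipation eta phi xi.
  by apply: Rintegral_ge0 => xi _; exact: dissipation_ge0.
have H0 : 0 <= \int[mu]_xi (rnorm (h xi) ^+ 2).
  by apply: Rintegral_ge0 => xi _; exact: sqr_ge0.
have : \int[mu]_t (c * \1_A t) <= \int[mu]_t
    (2 * c1 * omega * dissipation eta phi t + 2 * rnorm (h t) ^+ 2).
  apply: le_RintegralT.
  - exact: integrableTZ.
  - by apply: integrableTD; exact: integrableTZ.
  - move=> t; rewrite indicE; case: (boolP (t \in A)) => [|_].
      rewrite inE /A /= in_itv /= mulr1 => tA.
      exact: trace_bound_pointwise.
    have c10 : 0 <= 2 * c1 * omega.
      by rewrite !mulr_ge0 ?(ltW w0)// (le_trans ler01).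
    rewrite mulr0; apply: addr_ge0; apply: mulr_ge0 => //.
      exact: dissipation_ge0.
    exact: sqr_ge0.
rewrite RintegralZ// IA RintegralDT; [|exact: integrableTZ..].
rewrite !RintegralZ//; set D := (\int[mu]_xi dissipation eta phi xi) in D0 *.
set N := (\int[mu]_xi (rnorm (h xi) ^+ 2)) in H0 *.
have -> : c * r = rnorm z ^+ 2 * omega `^ alpha / 2 by rewrite /c -ra; ring.
move=> le1.
have wap : 0 < omega `^ alpha by exact: powR_gt0.
rewrite -(ler_pM2r wap); rewrite -/c1.
have -> : 4 * c1 * omega `^ (1 - alpha) * (D + N) * omega `^ alpha =
   4 * c1 * omega * (D + N) by rewrite -[in RHS]wa; ring.
have : N <= c1 * omega * N by rewrite ler_peMl// mulr_ege1.
rewrite mulrDr; lra.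
Qed.

End TraceBound.

(** * Classes of square integrable functions *)

Section L2Space.
Context {R : realType} {U : hilbertSpace R}.
Local Notation mu := (@lebesgue_measure R).
Implicit Types (x y : L2space U) (f g : R -> U).

Local Existing Instance ae_lebesgue_filter.

Lemma L2_reprP x : L2_function (L2_repr x).
Proof. by have := L2_valP (repr x); rewrite inE. Qed.

Definition L2_sqnorm x : R := \int[mu]_t (rnorm (L2_repr x t) ^+ 2).

Lemma L2_sqnorm_ge0 x : 0 <= L2_sqnorm x.
Proof. by apply: Rintegral_ge0 => t _; exact: sqr_ge0. Qed.

Lemma L2_dotpxx x : complex.Re (L2_dotp x x) = L2_sqnorm x.
Proof. by rewrite /L2_dotp /=; apply: eq_Rintegral => t _; rewrite -rdotxx. Qed.

Lemma L2_function_lin (a : R[i]) f g : L2_function f -> L2_function g ->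
  L2_function (a *: f - g).
Proof.
move=> lf lg; have [_ cl] := L2_pred_closed U.
have := cl (-1) g (a *: f); rewrite !inE => /(_ lg).
have := cl a f 0; rewrite !inE addr0 => /(_ lf).
have [z0 _] := L2_pred_closed U; rewrite inE in z0.
by move=> /(_ z0) h /(_ h) /=; rewrite scaleN1r addrC.
Qed.

(** A representative of a combination of classes is known up to a null set
    only. *)
Lemma L2_repr_scaleB (a : R[i]) x g : L2_function g ->
  {ae mu, forall t, L2_repr (a *: x - L2_class g) t = a *: L2_repr x t - g t}.
Proof.
move=> lg; pose G : L2fun U := insubd 0 g.
have GE : L2_val G = g by rewrite /G insubdK// inE.
have e : L2_pi (repr (a *: x - L2_class g)) = L2_pi (a *: repr x - G).
  rewrite L2_reprK L2_piD -scaleN1r -[in RHS]scaleN1r -!L2_scale_pi.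
  by rewrite L2_reprK.
have /L2_piP := e; apply: filterS => t; rewrite /L2_repr => ->.
by rewrite -GE.
Qed.

Lemma L2_sqnorm_scaleB (a : R[i]) x g : L2_function g ->
  L2_sqnorm (a *: x - L2_class g) =
  \int[mu]_t (rnorm (a *: L2_repr x t - g t) ^+ 2).
Proof.
move=> lg; rewrite /L2_sqnorm /Rintegral; congr fine.
have m f : L2_function f -> measurable_fun setT (fun t => (rnorm (f t) ^+
  2)%:E).
  by move=> lf; exact: (measurable_int _ (L2_function_integrable lf)).
apply: ae_eq_integral => //.
- by apply: m; exact: L2_reprP.
- by apply: (m (a *: L2_repr x - g)); apply: L2_function_lin => //;
    exact: L2_reprP.
- by apply: filterS (L2_repr_scaleB a x lg) => t -> _.
Qed.

End L2Space.

(** * The resolvent equation of calA *)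

Section FullSystem.
Context {R : realType} {H U : hilbertSpace R} (S : linearOperator H).
Variables (B : boundedToDual U S) (Bs : halfSpace S -> U).
Hypothesis hBs : is_adjoint B Bs.
Variables (alpha eta : R).
Hypothesis halpha : 0 < alpha < 1.
Local Notation gam := (damping_const alpha).

(** The squared norm of [calH]. *)
Definition energy (x : calH (U := U) S) : R := energy0 x.1 + gam * L2_sqnorm
  x.2.

Lemma energy_ge0 x : 0 <= energy x.
Proof.
apply: addr_ge0; first exact: energy0_ge0.
by rewrite mulr_ge0 ?L2_sqnorm_ge0// ltW// damping_const_gt0.
Qed.

Lemma calH_normE x : calH_norm U S alpha x = Num.sqrt (energy x).
Proof.
rewrite /calH_norm /calH_dotp !complex_Re_add; congr Num.sqrt.
rewrite /energy /energy0 -!rdotxx; congr (_ + _).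
rewrite -L2_dotpxx; case: (L2_dotp _ _) => a b /=.
by rewrite mul0r subr0.
Qed.

(** The components of the resolvent equation. The last one holds for every
    [xi], not just almost everywhere, because [h] is defined by it; only its
    norm is then compared with the one of the class [chi]. *)
Lemma calA_equations (omega : R) (u : halfSpace S) (v : H) (phi : L2space U)
    (f : halfSpace S) (g : H) (chi : L2space U) :
  dom (calA B Bs alpha eta) (u, v, phi) ->
  (0 +i* omega)%C *: (u, v, phi) - calA B Bs alpha eta (u, v, phi)
    = (f, g, chi) ->
  let z := Bs (to_half S v) in
  let ph := L2_repr phi in
  let h := fun xi =>
    (0 +i* omega)%C *: ph xi - diffusion Bs alpha eta v ph xi in
  let I := bochner_integral (fun xi => (weight alpha xi)%:C%C *: ph xi) in
  [/\ dom S v,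
     (0 +i* omega)%C *: half_val u - v = half_val f,
     forall w, rdot ((0 +i* omega)%C *: v) (half_val w)
       + rdot (S (half_val u)) (S (half_val w))
       + gam * rdot I (Bs w) = rdot g (half_val w),
     L2_function (fun xi => `|xi|%:C%C *: ph xi) &
     [/\ L2_function h,
      \int[@lebesgue_measure R]_t (rnorm (h t) ^+ 2) = L2_sqnorm chi &
      forall xi, (0 +i* omega)%C *: ph xi + (`|xi| ^+ 2 + eta)%:C%C *: ph xi =
        h xi + (weight alpha xi)%:C%C *: z]].
Proof.
move=> [/= dv hp Lx Ld] eq; split => //.
- have <- : half_val ((0 +i* omega)%C *: u - to_half S v) = half_val f.
    by move: eq => [] <- _ _.
  by rewrite half_valD half_valZ half_valN half_val_to_half.
- move=> w.
  have <- : (0 +i* omega)%C *: v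
      - - of_pivot (stress B alpha u (L2_repr phi)) = g by move: eq => [].
  rewrite opprK rdotDl -addrA; congr (_ + _).
  have -> : rdot (of_pivot (stress B alpha u (L2_repr phi))) (half_val w) =
      complex.Re (stress B alpha u (L2_repr phi) w) by rewrite -[in RHS](pivotK
        hp).
  rewrite /stress complex_Re_add; congr (_ + _).
  rewrite /rdot -hBs; case: (B _ _) => a b /=.
  by rewrite mul0r subr0.
- have Lh := L2_function_lin (0 +i* omega)%C (L2_reprP phi) Ld.
  split => //.
    have <- : (0 +i* omega)%C *: phi
       - L2_class (diffusion Bs alpha eta v (L2_repr phi)) = chi by move: eq =>
           [].
    by rewrite L2_sqnorm_scaleB.
  move=> xi; rewrite /diffusion opprD opprK -addrA; congr (_ + _).
  by rewrite subrK.
Qed.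

End FullSystem.

(** * The final estimate *)

(** The final combination, with [E] and [F] the energies of [(u, v)] and [(f,
    g)], [nphi], [nh], [z2], [i2], [k2] the squared norms of [phi], [chi],
    [z], [I] and [k]. All terms but the first are at most [m P] times a
    multiple of [D] and [nh]; the choice [t = 1 / (2 a m P)] makes the
    contribution of [D] at most half of the left-hand side plus a multiple of
    [(m P)^2] times the energy of [y]. *)
Lemma absorb_energy (R : realType)
    (gam eta cz ci a m P E F D nphi nh z2 i2 k2 : R) :
  0 < gam -> 0 < eta -> 0 < cz -> 0 <= ci -> 1 <= m -> 1 <= P ->
  0 <= F -> 0 <= D -> 0 <= nh ->
  eta * nphi <= D ->
  (forall t, 0 < t ->
    gam * D <= t * (E + gam * nphi) + t^-1 * (F + gam * nh)) ->
  z2 <= cz * P * (D + nh) -> i2 <= ci * D ->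
  k2 <= 2 * z2 + 2 * gam ^+ 2 * i2 ->
  E <= 8 * m ^+ 2 * F + 16 * m * k2 ->
  a = (32 * cz + 32 * gam ^+ 2 * ci + gam / eta) / gam ->
  E + gam * nphi <=
    2 * (8 + 2 * a ^+ 2 + 32 * cz / gam) * (m * P) ^+ 2 * (F + gam * nh).
Proof.
move=> g0 e0 z0 i0 m1 P1 F0 D0 nh0 hphi hD hz hi hk hE aE.
set X := E + gam * nphi in hD *; set Y := F + gam * nh in hD *.
have m0 : 0 < m by exact: lt_le_trans m1.
have P0 : 0 < P by exact: lt_le_trans P1.
pose q := m * P; have q1 : 1 <= q by exact: mulr_ege1.
have q0 : 0 < q by exact: lt_le_trans q1.
have Y0 : 0 <= Y by rewrite addr_ge0// mulr_ge0// ltW.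
have a0 : 0 < a.
  rewrite aE divr_gt0// ltr_wpDl ?divr_gt0//.
  by rewrite addr_ge0 ?mulr_ge0 ?(ltW z0) ?(ltW g0).
have nY : nh <= Y / gam by rewrite ler_pdivlMr// mulrC lerDr.
(* The pure data term and each of the dissipative terms, compared with [q = m
   P]. *)
have mq : m <= q by rewrite ler_peMr// ltW.
have h1 : 8 * m ^+ 2 * F <= 8 * q ^+ 2 * Y.
  apply: ler_pM => //; first by rewrite mulr_ge0 ?sqr_ge0.
    by rewrite ler_wpM2l// ler_sqr// nnegrE ltW.
  by rewrite lerDl mulr_ge0// ltW.
have h2 : m * z2 <= q * cz * (D + nh).
  have -> : q * cz * (D + nh) = m * (cz * P * (D + nh)) by rewrite /q; ring.
  by rewrite ler_wpM2l// ltW.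
have h3 : m * i2 <= q * (ci * D).
  apply: (@le_trans _ _ (m * (ci * D))); first by rewrite ler_wpM2l// ltW.
  by rewrite ler_wpM2r// mulr_ge0.
have h4 : gam * nphi <= q * (gam / eta * D).
  apply: (@le_trans _ _ (gam / eta * D)).
    rewrite -mulrA ler_wpM2l ?(ltW g0)// mulrC ler_pdivlMr//.
    by rewrite mulrC.
  by rewrite ler_peMl// mulr_ge0// ltW// divr_gt0.
have h5 : m * k2 <= 2 * (m * z2) + 2 * gam ^+ 2 * (m * i2).
  have -> : 2 * (m * z2) + 2 * gam ^+ 2 * (m * i2) =
    m * (2 * z2 + 2 * gam ^+ 2 * i2) by ring.
  by rewrite ler_wpM2l// ltW.
have h6 : gam ^+ 2 * (m * i2) <= gam ^+ 2 * (q * (ci * D)).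
  by rewrite ler_wpM2l// sqr_ge0.
have h7 : X <= 8 * q ^+ 2 * Y + q * (a * (gam * D)) + q * (32 * cz) * nh.
  have -> : q * (a * (gam * D)) =
    q * (32 * cz * D) + q * (32 * gam ^+ 2 * (ci * D)) + q * (gam / eta * D).
    by rewrite aE; field; rewrite !gt_eqF.
  rewrite /X; lra.
have t0 : 0 < (2 * a * q)^-1 by rewrite invr_gt0 !mulr_gt0.
have := hD _ t0; rewrite invrK => h8.
have h9 : q * (a * (gam * D)) <= X / 2 + 2 * a ^+ 2 * q ^+ 2 * Y.
  have -> : X / 2 + 2 * a ^+ 2 * q ^+ 2 * Y =
    q * (a * ((2 * a * q)^-1 * X + 2 * a * q * Y)).
    by field; rewrite !gt_eqF.
  by rewrite ler_wpM2l ?(ltW q0)// ler_wpM2l ?(ltW a0).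
have h10 : q * (32 * cz) * nh <= 32 * cz / gam * q ^+ 2 * Y.
  have -> : 32 * cz / gam * q ^+ 2 * Y = q * (32 * cz) * (q * (Y / gam)).
    by field; rewrite gt_eqF.
  apply: ler_wpM2l.
    by apply: mulr_ge0; [exact: ltW|apply: mulr_ge0 => //; exact: ltW].
  by apply: le_trans nY _; rewrite ler_peMl// divr_ge0// ltW.
rewrite -/q; lra.
Qed.

Section MainEstimate.
Context {R : realType} {H U : hilbertSpace R} (S : linearOperator H).
Variables (B : boundedToDual U S) (Bs : halfSpace S -> U).
Hypothesis hBs : is_adjoint B Bs.
Variables (alpha eta : R).
Hypotheses (halpha : 0 < alpha < 1) (heta : 0 < eta).
Local Notation gam := (damping_const alpha).
Local Notation mu := (@lebesgue_measure R).

(** The stress equation tested with the velocity: the inertial term has no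
    real part, and the elastic one reduces to [- <S u, S f>]. *)
Lemma energy_identity (omega : R) (u f : halfSpace S) (v g : H) (phi h : R -> U)
    (I : U) :
  dom S v -> (0 +i* omega)%C *: half_val u - v = half_val f ->
  (forall w, rdot ((0 +i* omega)%C *: v) (half_val w)
       + rdot (S (half_val u)) (S (half_val w))
       + gam * rdot I (Bs w) = rdot g (half_val w)) ->
  rdot I (Bs (to_half S v)) =
    \int[mu]_xi dissipation eta phi xi - \int[mu]_xi rdot (phi xi) (h xi) ->
  gam * \int[mu]_xi dissipation eta phi xi =
    rdot v g + rdot (S (half_val u)) (S (half_val f)) +
    gam * \int[mu]_xi rdot (phi xi) (h xi).
Proof.
move=> dv e1 e2 eI; have := e2 (to_half S v); rewrite eI half_val_to_half//.
rewrite (half_op_velocity dv e1).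
rewrite rdot_skew0 rdotBr [rdot _ (_ *: _)]rdotC rdot_skew0 [rdot g v]rdotC.
rewrite mulrBr; lra.
Qed.

(** The source seen by [calA0] is [k = B^* v - gamma I]: it measures how far
    the fractional damping is from the damping by [B B^*]. *)
Lemma resolvent_energy_bound : exists2 C : R, 0 < C &
  forall (omega m : R) (x y : calH (U := U) S), 1 <= omega -> 1 <= m ->
    resolvent_set (calH0_norm S) (calA0 B Bs) (0 +i* - omega)%C ->
    (forall y0, energy0 (resolvent (calA0 B Bs) (0 +i* - omega)%C y0)
      <= m ^+ 2 * energy0 y0) ->
    dom (calA B Bs alpha eta) x ->
    (0 +i* omega)%C *: x - calA B Bs alpha eta x = y ->
    energy alpha x <= C * (m * omega `^ (1 - alpha)) ^+ 2 * energy alpha y.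
Proof.
have g0 := damping_const_gt0 halpha.
pose Q := \int[mu]_xi weight_density alpha eta xi.
have Q0 : 0 <= Q.
  by apply: Rintegral_ge0 => xi _; exact: weight_density_ge0.
pose cz := 4 * (1 + (4 + eta) ^+ 2).
have cz0 : 0 < cz by rewrite mulr_gt0// ltr_wpDr ?sqr_ge0.
pose ci := 2 * (2 * Q + 1).
have ci0 : 0 <= ci by rewrite mulr_ge0// addr_ge0// mulr_ge0.
pose a := (32 * cz + 32 * gam ^+ 2 * ci + gam / eta) / gam.
exists (2 * (8 + 2 * a ^+ 2 + 32 * cz / gam)).
  have b0 : 0 <= 32 * cz / gam.
    by apply: divr_ge0; [apply: mulr_ge0 => //|]; exact: ltW.
  by have := sqr_ge0 a; lra.
move=> omega m [[u v] phi] [[f g] chi] w1 m1 hl hm dx ex.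
have [dv e1 e2 Lx [Lh nh heq]] := calA_equations hBs dx ex.
set z := Bs (to_half S v) in heq; set I := bochner_integral _ in e2.
set h := (fun xi => _) in Lh nh heq; set ph := L2_repr phi in e2 Lx heq.
have Lp : L2_function ph by exact: L2_reprP.
have eI := bochner_wphi_energy halpha heta Lp Lh Lx heq.
have := energy_identity dv e1 e2 eI.
have bI := bochner_wphi_bound halpha heta Lp Lx.
have bz := trace_bound halpha heta w1 Lp Lh Lx heq.
set D := (\int[mu]_xi dissipation eta ph xi) in bI bz *.
move=> eD.
rewrite /energy.
apply: (absorb_energy (eta := eta) (cz := cz) (ci := ci) (D := D) (z2 := rnorm
  z ^+ 2) (i2 := rnorm I ^+ 2)
  (k2 := rnorm (z - gam%:C%C *: I) ^+ 2)) => //.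
- rewrite -{1}(powRr0 omega) ler_powR// subr_ge0.
  by case/andP: halpha => _ /ltW.
- exact: energy0_ge0.
- by apply: Rintegral_ge0 => xi _; exact: dissipation_ge0.
- exact: L2_sqnorm_ge0.
- rewrite -RintegralZ; last exact: L2_function_integrable.
  apply: le_RintegralT.
  + by apply: integrableTZ; exact: L2_function_integrable.
  + exact: integrableT_dissipation.
  + by move=> xi; rewrite /dissipation ler_wpM2r ?sqr_ge0// lerDr sqr_ge0.
- move=> t t0; rewrite eD -nh.
  have y1 := rdot_young v g t0.
  have y2 := rdot_young (S (half_val u)) (S (half_val f)) t0.
  have y3 := Rintegral_rdot_young t0 Lp Lh.
  have := ler_wpM2l (ltW g0) y3.
  rewrite /energy0 /= /L2_sqnorm -/ph; lra.
- by rewrite -nh.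
- apply: le_trans (sqr_rnormD_le _ _) _.
  rewrite rnormN rnormZr exprMn real_normK ?num_real//; lra.
- have m0 : 0 < m by exact: lt_le_trans m1.
  have dd := dual_estimate hBs hl m0 hm dv e1.
  apply: (dd g) => w; rewrite rdotBl rdotZl -e2; ring.
Qed.

End MainEstimate.

Theorem theorem6p1 (R : realType) (H U : hilbertSpace R)
  (A S : linearOperator H)
  (hA : selfadjoint A) (hA0 : strictly_positive A) (hS : is_sqrt S A)
  (B : boundedToDual U S) (Bs : halfSpace S -> U) (hBs : is_adjoint B Bs)
  (alpha eta : R) (halpha : 0 < alpha < 1) (heta : 0 < eta)
  (M : R -> R)
  (hM : {in `[0, +oo[ &, {homo M : x y / x <= y}})
  (hM0 : forall x, 0 < x -> 0 < M x)
  (hrho : forall omega : R,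
    resolvent_set (calH_norm U S alpha) (calA B Bs alpha eta) (0 +i* omega)%C)
  (hrho0 : forall omega : R,
    resolvent_set (calH0_norm S) (calA0 B Bs) (0 +i* omega)%C)
  (hlimsup : (limf_esup (fun omega : R =>
      opnorm (calH0_norm S) (fun y => ((M `|omega|)^-1)%:C%C *:
        resolvent (calA0 B Bs) (0 +i* omega)%C y)%R)
    (abs_infty R) < +oo)%E) :
  exists2 C : R, 0 < C &
    forall omega : R, 1 <= omega ->
      (opnorm (calH_norm U S alpha)
         (resolvent (calA B Bs alpha eta) (0 +i* omega)%C)%R
       <= (C * `|omega| `^ (1 - alpha) * M `|omega|)%:E)%E.
Proof.
have denseS : dense (dom S) by case: hS => [[]].
have [K K0 hK] := resolvent0_uniform_bound hBs denseS hM hM0 hrho0 hlimsup.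
have [C C0 hC] := resolvent_energy_bound hBs halpha heta.
exists (Num.sqrt C * K); first by rewrite mulr_gt0 ?sqrtr_gt0.
move=> omega w1; have w0 : 0 < omega by exact: lt_le_trans w1.
have nw : `|- omega| = omega by rewrite normrN gtr0_norm.
have [] := hK (- omega); rewrite nw// => m1 hm; rewrite gtr0_norm//.
apply: ge_ereal_sup => _ [y /= y1 <-]; rewrite lee_fin.
have [dx ex] := resolventP (hrho omega) y.
have := hC omega (K * M omega) _ y w1 m1 (hrho0 _) hm dx ex.
set x := resolvent _ _ y => le.
rewrite !calH_normE in y1 *.
have ey : energy alpha y <= 1.
  rewrite -(sqr_sqrtr (energy_ge0 halpha y)).
  by rewrite expr_le1// sqrtr_ge0.
have -> : Num.sqrt C * K * omega `^ (1 - alpha) * M omega =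
    Num.sqrt (C * (K * M omega * omega `^ (1 - alpha)) ^+ 2).
  rewrite sqrtrM ?(ltW C0)// sqrtr_sqr ger0_norm; first by ring.
  by rewrite mulr_ge0 ?powR_ge0// (le_trans ler01).
rewrite ler_wsqrtr//; apply: le_trans le _.
by rewrite ler_piMr// mulr_ge0 ?sqr_ge0// ltW.
Qed.
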